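(* Let $A,N\in\mathbb{R}^{n\times n}$, $B\in\mathbb{R}^{n\times m}$, $C\in\mathbb{R}^{p\times n}$, and assume $$\sigma(I\otimes A+A\otimes I+N\otimes N)\subset\mathbb{C}_-.$$ Assume furthermore that for $\Sigma=\operatorname{diag}(\Sigma_1,\Sigma_2)>0$ with $\Sigma_2=\operatorname{diag}(\sigma_{r+1}I,\ldots,\sigma_\nu I)$, where $\sigma_{r+1}>\cdots>\sigma_\nu>0$, and $\sigma(\Sigma_1)\cap\sigma(\Sigma_2)=\emptyset$, the following Lyapunov inequalities hold: $$A^T\Sigma+\Sigma A+N^T\Sigma N\le -C^TC,$$ $$A^T\Sigma^{-1}+\Sigma^{-1}A+N^T\Sigma^{-1}N\le -\Sigma^{-1}BB^T\Sigma^{-1}.$$ Partition, conformally with $\Sigma=\operatorname{diag}(\Sigma_1,\Sigma_2)$, $$A=\begin{bmatrix} A_{11} & A_{12} \\ A_{21} & A_{22} \end{bmatrix},\quad N=\begin{bmatrix} N_{11} & N_{12} \\ N_{21} & N_{22} \end{bmatrix},\quad B=\begin{bmatrix} B_1 \\ B_2 \end{bmatrix},\quad C=\begin{bmatrix} C_1 & C_2 \end{bmatrix}.$$ For an input $u$, let $y$ be the output of the system $$dx=Ax\,dt+Nx\,dw+Bu\,dt,\qquad y=Cx,\qquad x(0)=0,$$ and let $y_r$ be the output of the truncated system $$dx_r=A_{11}x_r\,dt+N_{11}x_r\,dw+B_1u\,dt,\qquad y_r=C_1x_r,\qquad x_r(0)=0.$$ Then for all $T>0$ and all inputs $u\in L^2_w([0,T],\mathbb{R}^m)$,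 $$\|y-y_r\|_{L^2_w([0,T])}\le 2(\sigma_{r+1}+\cdots+\sigma_\nu)\,\|u\|_{L^2_w([0,T])}.$$
   Context: $\sigma(\cdot)$ with a matrix argument denotes the spectrum (while $\sigma_j$ with an index denotes a positive number), $\mathbb{C}_-$ is the open left half complex plane, $\otimes$ is the Kronecker product, and $I$ denotes identity matrices of appropriate (possibly different) sizes. For real symmetric matrices, $X>0$ means positive definite and $X\le Y$ means $Y-X$ is positive semidefinite; $\Sigma>0$ includes that $\Sigma$ is real symmetric. The stochastic differential equations are understood in the It\^o sense; $w=(w(t))_{t\ge 0}$ is a zero mean real (standard) Wiener process on a probability space $(\Omega,\mathcal{F},\mu)$ with respect to an increasing family $(\mathcal{F}_t)_{t\ge0}$ of $\sigma$-algebras $\mathcal{F}_t\subset\mathcal{F}$. Both systems are driven by the same $w$ and the same input $u$. $L^2_w([0,T],\mathbb{R}^q)$ denotes the space of non-anticipating (i.e. adapted to $(\mathcal{F}_t)$) stochastic processes $v$ on $[0,T]$ with values in $\mathbb{R}^q$ and finite norm $$\|v\|_{L^2_w([0,T])}=\left(\mathcal{E}\int_0^T\|v(t)\|^2\,dt\right)^{1/2}<\infty,$$ where $\mathcal{E}$ denotes expectation and $\|\cdot\|$ the Euclidean norm. *)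

(* Defs.v *)
From HB Require Import structures.
From mathcomp Require Import all_boot all_order all_algebra.
From mathcomp Require Import mxtens complex.
From mathcomp Require Import all_classical all_reals all_analysis.

Set Implicit Arguments.
Unset Strict Implicit.
Unset Printing Implicit Defensive.

Import Order.TTheory GRing.Theory Num.Theory.
Import numFieldNormedType.Exports.

Local Open Scope classical_set_scope.
Local Open Scope ring_scope.

Section Matrices.
Variable R : realType.

Definition spectrum n (M : 'M[R]_n) : set R[i] :=
  [set z | eigenvalue (map_mx (real_complex R) M) z].

Definition open_left_half_plane : set R[i] := [set z | complex.Re z < 0].

Definition quadform n (X : 'M[R]_n) (v : 'cV[R]_n) : R :=
  (v^T *m X *m v) 0 0.

Definition posdefmx n (X : 'M[R]_n) : Prop :=
  X^T = X /\ forall v : 'cV[R]_n, v != 0 -> 0 < quadform X v.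

Definition possemidefmx n (X : 'M[R]_n) : Prop :=
  X^T = X /\ forall v : 'cV[R]_n, 0 <= quadform X v.

Definition loewner_le n (X Y : 'M[R]_n) : Prop := possemidefmx (Y - X).

(* Squared Euclidean norm; the library's `|v| on matrices is the sup norm. *)
Definition sqnorm2 n (v : 'cV[R]_n) : R := \sum_(i < n) v i 0 ^+ 2.

End Matrices.

Section StochasticCalculus.
Context (R : realType) (d : measure_display) (Omega : measurableType d).
Variable P : probability Omega R.

(* Families indexed by time are functions on all of R; only their values at
   nonnegative times are ever constrained or used. *)
Definition is_filtration (F : R -> set (set Omega)) : Prop :=
  [/\ forall t : R, 0 <= t -> sigma_algebra setT (F t),
      forall t : R, 0 <= t -> F t `<=` measurable
    & forall s t : R, 0 <= s -> s <= t -> F s `<=` F t].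

Definition measurable_wrt (G : set (set Omega)) (X : Omega -> R) : Prop :=
  forall Y : set R, measurable Y -> G (X @^-1` Y).

(* Standard Wiener process relative to F. The second parameter of normal_prob
   is the standard deviation. *)
Definition is_wiener (F : R -> set (set Omega)) (w : R -> Omega -> R) : Prop :=
  [/\ forall t : R, 0 <= t -> measurable_wrt (F t) (w t),
      {ae P, forall om, w 0 om = 0},
      forall s t : R, 0 <= s -> s < t -> forall Y : set R, measurable Y ->
        P ((w t \- w s) @^-1` Y) = normal_prob 0 (Num.sqrt (t - s)) Y,
      forall s t : R, 0 <= s -> s < t ->
        forall (D : set Omega) (Y : set R), F s D -> measurable Y ->
        P (D `&` (w t \- w s) @^-1` Y) = (P D * P ((w t \- w s)%R @^-1` Y))%E
    & {ae P, forall om, {within `[0, +oo[, continuous (w ^~ om)}}].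

Definition process n := R -> Omega -> 'cV[R]_n.

Definition L2w_norm n (T : R) (v : process n) : \bar R :=
  sqrte (\int[P]_om
    \int[lebesgue_measure]_(t in `[0%R, T]) (sqnorm2 (v t om))%:E)%E.

Definition in_L2w (F : R -> set (set Omega)) n (T : R) (v : process n) : Prop :=
  [/\ forall i, measurable_fun (`[0, T] `*` setT)
                  (fun p : R * Omega => v p.1 p.2 i 0),
      forall t : R, 0 <= t <= T -> forall i, measurable_wrt (F t) (fun om => v t om i 0)
    & (L2w_norm T v < +oo)%E].

(* The process \sum_(j < k) xi_j 1_]t_j, t_(j+1)] with 0 <= t_0 <= ... <= t_k
   and xi_j bounded and F_(t_j)-measurable. *)
Record simple_process (F : R -> set (set Omega)) n := SimpleProcess {
  sp_size : nat;
  sp_time : nat -> R;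
  sp_coef : nat -> Omega -> 'cV[R]_n;
  sp_time_ge0 : 0 <= sp_time 0%N;
  sp_time_le : forall j, (j < sp_size)%N -> sp_time j <= sp_time j.+1;
  sp_coef_measurable : forall j, (j < sp_size)%N ->
    forall i, measurable_wrt (F (sp_time j)) (fun om => sp_coef j om i 0);
  sp_coef_bounded : forall j, (j < sp_size)%N ->
    exists M : R, forall om i, `|sp_coef j om i 0| <= M
}.

Definition simple_val F n (S : simple_process F n) : process n := fun t om =>
  \sum_(j < sp_size S | sp_time S j < t <= sp_time S j.+1) sp_coef S j om.

(* \int_0^t S dw for a simple process S *)
Definition simple_integral F n (S : simple_process F n) (w : R -> Omega -> R)
    (t : R) (om : Omega) : 'cV[R]_n :=
  \sum_(j < sp_size S)
    (w (Num.min (sp_time S j.+1) t) om - w (Num.min (sp_time S j) t) om)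
      *: sp_coef S j om.

(* Z is (a version of) the Ito integral \int_0^t f dw: f is an L^2_w-limit of
   simple processes on [0, t], and Z is the L^2(P)-limit of their integrals.
   By the Ito isometry, Z is unique up to P-null sets and does not depend on
   the approximating sequence. *)
Definition is_ito_integral F (w : R -> Omega -> R) n (f : process n) (t : R)
    (Z : Omega -> 'cV[R]_n) : Prop :=
  [/\ in_L2w F t f, forall i, measurable_fun setT (fun om => Z om i 0)
    & exists S : nat -> simple_process F n,
        (fun k => L2w_norm t (fun s om => f s om - simple_val (S k) s om))
          @ \oo --> 0%E
        /\ (fun k => \int[P]_om
              (sqnorm2 (Z om - simple_integral (S k) w t om))%:E)%E
          @ \oo --> 0%E].

(* x solves dx = A x dt + N x dw + B u dt, x(0) = x0, on [0, T] in the Ito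
   sense, i.e. for every t in [0, T], almost surely,
   x(t) = x0 + \int_0^t (A x + B u) ds + \int_0^t N x dw. *)
Definition is_sde_solution F (w : R -> Omega -> R) n m (T : R)
    (A N : 'M[R]_n) (B : 'M[R]_(n, m)) (u : process m) (x0 : 'cV[R]_n)
    (x : process n) : Prop :=
  in_L2w F T x /\
  forall t : R, 0 <= t <= T ->
    exists2 Z : Omega -> 'cV[R]_n,
      is_ito_integral F w (fun s om => N *m x s om) t Z &
      {ae P, forall om, x t om =
         x0 + (\col_i \int[lebesgue_measure]_(s in `[0, t])
                        ((A *m x s om + B *m u s om) i 0)) + Z om}.

End StochasticCalculus.

(* Main.v *)
Require Import Defs.
From HB Require Import structures.
From mathcomp Require Import all_boot all_order all_algebra.
From mathcomp Require Import ring lra.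
From mathcomp Require Import mxtens complex.
From mathcomp Require Import all_classical all_reals all_analysis.
From mathcomp Require Import measurable_realfun.

Set Implicit Arguments.
Unset Strict Implicit.
Unset Printing Implicit Defensive.

Import Order.TTheory GRing.Theory Num.Theory.
Import numFieldNormedType.Exports.

Local Open Scope classical_set_scope.
Local Open Scope ring_scope.

(** The error bound is an energy balance.  Let a storage function be a
    nonnegative quadratic form W in the states (x, y) of two systems driven by
    the same input u and the same noise.  If its drift, including the Ito
    correction, is at most g^2 |u|^2 minus the squared output error, then
    integrating up to T and taking expectations gives
    0 <= E W(x(T), y(T)) <= g^2 |u|^2 - |error|^2 in the norms of the statement
    ([dissipation_L2w_le]).  It remains to find W for the original and the
    truncated system with g = 2 (sigma_{r+1} + ... + sigma_nu), which is linear
    algebra ([truncation_storage]).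

    For one removed block with value sigma, W is built from Sigma and its
    inverse, applied to the difference and to the sum of the two states; the two
    Lyapunov inequalities give g = 2 sigma ([truncation_step]).  For several
    blocks one would pass through the intermediate truncations and use the
    triangle inequality, which requires solutions of the intermediate stochastic
    equations.  Instead the storage functions themselves are composed: a weighted
    sum is minimized over the intermediate state, and the gains add up
    ([dissipation_trans]).

    The only stochastic analysis needed is Ito's formula for quadratic functions,
    in expectation and at the single time T ([ito_formula_sqr], polarized in
    [ito_formula_mul]).  It follows from three facts: the Ito isometry, the
    martingale property of the integral tested against adapted
    square-integrable variables, and the identity E D(T)^2 = 2 E int a D for the
    primitive D of the drift a.  The first two rest on the pairwise isometry for
    two intervals ([ip_incr_incr]), which uses the independence and the Gaussian
    moments of the Wiener increments. *)

(** * Bilinear forms and positive definite matrices *)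

Section BilinearForms.
Context {R : realType}.

Definition bil n (W : 'M[R]_n) (x y : 'cV[R]_n) : R := (x^T *m W *m y) 0 0.

Lemma bilE n (W : 'M[R]_n) x : quadform W x = bil W x x.
Proof. by []. Qed.

Lemma bilDl n (W : 'M[R]_n) x y z : bil W (x + y) z = bil W x z + bil W y z.
Proof. by rewrite /bil linearD /= !mulmxDl mxE. Qed.

Lemma bilDr n (W : 'M[R]_n) x y z : bil W z (x + y) = bil W z x + bil W z y.
Proof. by rewrite /bil mulmxDr mxE. Qed.

Lemma bilNl n (W : 'M[R]_n) x z : bil W (- x) z = - bil W x z.
Proof. by rewrite /bil linearN /= !mulNmx mxE. Qed.

Lemma bilNr n (W : 'M[R]_n) x z : bil W z (- x) = - bil W z x.
Proof. by rewrite /bil mulmxN mxE. Qed.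

Lemma bilZr n (W : 'M[R]_n) a x z : bil W z (a *: x) = a * bil W z x.
Proof. by rewrite /bil -scalemxAr mxE. Qed.

Lemma bil0l n (W : 'M[R]_n) z : bil W 0 z = 0.
Proof. by rewrite /bil trmx0 !mul0mx mxE. Qed.

Lemma bil0r n (W : 'M[R]_n) z : bil W z 0 = 0.
Proof. by rewrite /bil mulmx0 mxE. Qed.

Lemma bil_addmx n (W V : 'M[R]_n) x z : bil (W + V) x z = bil W x z + bil V x z.
Proof. by rewrite /bil mulmxDr mulmxDl mxE. Qed.

Lemma bil_oppmx n (W : 'M[R]_n) x z : bil (- W) x z = - bil W x z.
Proof. by rewrite /bil mulmxN mulNmx mxE. Qed.

Lemma bil_scalemx n (W : 'M[R]_n) a x z : bil (a *: W) x z = a * bil W x z.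
Proof. by rewrite /bil -scalemxAr -scalemxAl mxE. Qed.

Lemma bilMl n (W M : 'M[R]_n) x z : bil W (M *m x) z = bil (M^T *m W) x z.
Proof. by rewrite /bil trmx_mul !mulmxA. Qed.

Lemma bilMr n (W M : 'M[R]_n) x z : bil W x (M *m z) = bil (W *m M) x z.
Proof. by rewrite /bil !mulmxA. Qed.

Lemma bil_congr n p (W : 'M[R]_n) (J : 'M[R]_(n, p)) x z :
  bil (J^T *m W *m J) x z = bil W (J *m x) (J *m z).
Proof. by rewrite /bil trmx_mul !mulmxA. Qed.

Lemma bilC n (W : 'M[R]_n) x y : W^T = W -> bil W x y = bil W y x.
Proof.
move=> WT; rewrite /bil (_ : x^T *m W *m y = (y^T *m W *m x)^T) ?mxE//.
by rewrite !trmx_mul trmxK WT mulmxA.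
Qed.

Lemma bil_sum n (W : 'M[R]_n) x y :
  bil W x y = \sum_i \sum_j W i j * (x i 0 * y j 0).
Proof.
rewrite /bil mxE exchange_big/=; apply: eq_bigr => j _.
rewrite mxE mulr_suml; apply: eq_bigr => i _; rewrite mxE; ring.
Qed.

Lemma sqnorm2E n (v : 'cV[R]_n) : sqnorm2 v = bil 1%:M v v.
Proof.
rewrite /sqnorm2 /bil mulmx1 mxE; apply: eq_bigr => i _.
by rewrite mxE expr2.
Qed.

Lemma sqnorm2_ge0 n (v : 'cV[R]_n) : 0 <= sqnorm2 v.
Proof. by apply: sumr_ge0 => i _; exact: sqr_ge0. Qed.

Lemma sqnorm2_eq0 n (v : 'cV[R]_n) : sqnorm2 v = 0 -> v = 0.
Proof.
move=> v0; apply/matrixP => i j; rewrite ord1 mxE; apply/eqP.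
rewrite -sqrf_eq0; apply/eqP.
by apply: (psumr_eq0P _ v0) => // k _; exact: sqr_ge0.
Qed.

Lemma bil1C n (x y : 'cV[R]_n) : bil 1%:M x y = bil 1%:M y x.
Proof. by apply: bilC; rewrite trmx1. Qed.

Lemma bil_sqnorm_mul n p (M : 'M[R]_(p, n)) x :
  bil (M^T *m M) x x = sqnorm2 (M *m x).
Proof. by rewrite sqnorm2E -bil_congr mulmx1. Qed.

Lemma posdef_ge0 n (W : 'M[R]_n) : posdefmx W -> forall v, 0 <= bil W v v.
Proof.
case=> _ W0 v; have [->|/W0/ltW//] := eqVneq v 0.
by rewrite bil0l.
Qed.

Lemma posdef_eq0 n (W : 'M[R]_n) v : posdefmx W -> bil W v v <= 0 -> v = 0.
Proof.
case=> _ W0 h; apply/eqP; apply/negP => /negP/W0; rewrite bilE => h'.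
by move: (lt_le_trans h' h); rewrite ltxx.
Qed.

Lemma posdef_unitmx n (W : 'M[R]_n) : posdefmx W -> W \in unitmx.
Proof.
move=> pW; rewrite -row_free_unit; apply: inj_row_free => v vW.
rewrite -[v]trmxK (_ : v^T = 0) ?trmx0//; apply: (posdef_eq0 pW).
by rewrite /bil trmxK vW mul0mx mxE.
Qed.

Lemma posdef_invmx n (W : 'M[R]_n) : posdefmx W -> posdefmx (invmx W).
Proof.
move=> pW; have Wu := posdef_unitmx pW; have [WT W0] := pW; split.
  by rewrite trmx_inv WT.
move=> v v0; have h : v = W *m (invmx W *m v) by rewrite mulKVmx.
rewrite bilE {1 2}h bilMl WT mulmxV// bilMr mul1mx; apply: W0.
by apply: contra v0 => /eqP v0; rewrite h v0 mulmx0.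
Qed.

(** Minimizing a positive definite form over its last block of variables gives
    a linear minimizer, characterized by stationarity. *)
Lemma posdef_partial_min p q (G : 'M[R]_(p + q)) : posdefmx G ->
  exists L : 'M[R]_(q, p), forall v d,
    bil G (col_mx v (L *m v)) (col_mx 0 d) = 0.
Proof.
move=> pG; have [GT _] := pG.
have pD : posdefmx (drsubmx G).
  split.
    by rewrite -[in RHS]GT -[in RHS](submxK G) tr_block_mx block_mxKdr.
  move=> v v0; have := pG.2 (col_mx 0 v).
  rewrite -[in X in X -> _](submxK G) bilE /bil /quadform tr_col_mx trmx0.
  rewrite mul_row_block mul_row_col !mul0mx !add0r mulmx0 add0r; apply.
  by apply: contra v0; rewrite col_mx_eq0 => /andP[].
exists (- (invmx (drsubmx G) *m dlsubmx G)) => v d.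
rewrite (bilC _ _ GT) /bil -(submxK G) tr_col_mx trmx0 mul_row_block.
rewrite !mul0mx !add0r mul_row_col !block_mxKdl !block_mxKdr.
rewrite mulNmx mulmxN !mulmxA -[d^T *m _ *m invmx _]mulmxA.
by rewrite (mulmxV (posdef_unitmx pD)) mulmx1 subrr mxE.
Qed.

End BilinearForms.

(** * Dissipation inequalities for pairs of systems *)

Section Dissipation.
Context {R : realType}.

(** Coefficients of dx = (A x + B u) dt + N x dw, y = C x. *)
Record system n m p := System {
  sysA : 'M[R]_n; sysN : 'M[R]_n; sysB : 'M[R]_(n, m); sysC : 'M[R]_(p, n) }.

Definition sys_drift n m p (S : system n m p) (x : 'cV[R]_n) (u : 'cV[R]_m) :=
  sysA S *m x + sysB S *m u.

(** The left-hand side is the drift of the quadratic functional with matrix W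
    along the pair of states (x1, x2), both systems being driven by the same
    input and the same noise; its second summand is the Ito correction.  So W
    stores energy supplied at rate g^2 |u|^2 while paying for the squared output
    error. *)
Definition dissipation n1 n2 m p (S1 : system n1 m p) (S2 : system n2 m p)
    (g : R) (W : 'M[R]_(n1 + n2)) : Prop :=
  forall x1 x2 u,
    2 * bil W (col_mx x1 x2) (col_mx (sys_drift S1 x1 u) (sys_drift S2 x2 u))
    + bil W (col_mx (sysN S1 *m x1) (sysN S2 *m x2))
            (col_mx (sysN S1 *m x1) (sysN S2 *m x2))
    <= g ^+ 2 * sqnorm2 u - sqnorm2 (sysC S1 *m x1 - sysC S2 *m x2).

(** Weighted Cauchy--Schwarz: the weights make the constants of two
    dissipation inequalities add up. *)
Lemma sqnorm2D_weighted p (g h : R) (v w : 'cV[R]_p) : 0 < g -> 0 < h ->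
  sqnorm2 (v + w) <= (1 + h / g) * sqnorm2 v + (1 + g / h) * sqnorm2 w.
Proof.
move=> g0 h0; have gn0 := lt0r_neq0 g0; have hn0 := lt0r_neq0 h0.
have : 0 <= (g * h)^-1 * sqnorm2 (h *: v - g *: w).
  by rewrite mulr_ge0 ?sqnorm2_ge0// invr_ge0 mulr_ge0// ltW.
rewrite !sqnorm2E !(bilDl, bilDr, bilNl, bilNr, bilZr).
have bZl c x y : bil (1%:M : 'M[R]_p) (c *: x) y = c * bil 1%:M x y.
  by rewrite bil1C bilZr bil1C.
rewrite !bZl (bil1C w v) => H; rewrite -subr_ge0.
apply: le_trans H _; rewrite le_eqVlt; apply/orP; left; apply/eqP.
by field; apply/andP.
Qed.

(** Storage functions for (S1, S2) and (S2, S3) compose: take the weighted sum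
    of the two and minimize it over the state of S2.  The minimizer is a linear
    function of the two outer states.  By stationarity the drift of the minimum
    does not see how the middle state moves, and the Ito correction of the
    minimum is at most that of the sum at any middle noise; so the minimum
    inherits the dissipation inequality.  Hence no trajectory of S2 has to exist. *)
Lemma dissipation_trans n1 n2 n3 m p (S1 : system n1 m p) (S2 : system n2 m p)
    (S3 : system n3 m p) (g h : R) (V : 'M[R]_(n1 + n2)) (W : 'M[R]_(n2 + n3)) :
  0 < g -> 0 < h -> posdefmx V -> posdefmx W ->
  dissipation S1 S2 g V -> dissipation S2 S3 h W ->
  exists2 U : 'M[R]_(n1 + n3), posdefmx U & dissipation S1 S3 (g + h) U.
Proof.
move=> g0 h0 pV pW dV dW.
pose J1 : 'M[R]_(n1 + n2, (n1 + n3) + n2) :=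
  col_mx (row_mx (row_mx 1%:M 0) 0) (row_mx (row_mx 0 0) 1%:M).
pose J2 : 'M[R]_(n2 + n3, (n1 + n3) + n2) :=
  col_mx (row_mx (row_mx 0 0) 1%:M) (row_mx (row_mx 0 1%:M) 0).
have J1E x y z : J1 *m col_mx (col_mx x z) y = col_mx x y :> 'cV[R]_(n1 + n2).
  by rewrite /J1 !(mul_col_mx, mul_row_col) !mul0mx !mul1mx !addr0 !add0r.
have J2E x y z : J2 *m col_mx (col_mx x z) y = col_mx y z :> 'cV[R]_(n2 + n3).
  by rewrite /J2 !(mul_col_mx, mul_row_col) !mul0mx !mul1mx !addr0 !add0r.
pose c := 1 + h / g; pose e := 1 + g / h.
have c0 : 0 < c by rewrite addr_gt0// divr_gt0.
have e0 : 0 < e by rewrite addr_gt0// divr_gt0.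
pose G := c *: (J1^T *m V *m J1) + e *: (J2^T *m W *m J2).
have GE v w : bil G v w = c * bil V (J1 *m v) (J1 *m w)
                        + e * bil W (J2 *m v) (J2 *m w).
  by rewrite bil_addmx !bil_scalemx !bil_congr.
have G_ge0 v : 0 <= bil G v v.
  by rewrite GE addr_ge0// mulr_ge0 ?posdef_ge0// ltW.
have pG : posdefmx G.
  split.
    rewrite linearD !linearZ/= !trmx_mul !trmxK !mulmxA.
    by case: pV pW => -> _ [-> _].
  move=> v; apply: contra_neqT; rewrite -leNgt bilE GE => le0.
  have V_ge0 := posdef_ge0 pV (J1 *m v); have W_ge0 := posdef_ge0 pW (J2 *m v).
  have /(posdef_eq0 pV) : bil V (J1 *m v) (J1 *m v) <= 0 by nra.
  have /(posdef_eq0 pW) : bil W (J2 *m v) (J2 *m v) <= 0 by nra.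
  rewrite -(vsubmxK v) -(vsubmxK (usubmx v)) J1E J2E.
  move=> /eqP; rewrite col_mx_eq0 => /andP[/eqP-> /eqP->].
  move=> /eqP; rewrite col_mx_eq0 => /andP[/eqP-> _].
  by rewrite !col_mx0.
(* J embeds the outer states along the minimizer; bil G (J v) (J w) is the
   minimized form *)
have [L LE] := posdef_partial_min pG.
have GT := pG.1.
pose J : 'M[R]_((n1 + n3) + n2, n1 + n3) := col_mx 1%:M L.
have JE v : J *m v = col_mx v (L *m v) by rewrite mul_col_mx mul1mx.
have move_mid v w (y : 'cV[R]_n2) :
    bil G (J *m v) (J *m w) = bil G (J *m v) (col_mx w y).
  apply/eqP; rewrite -subr_eq0 -bilNr -bilDr !JE opp_col_mx add_col_mx subrr.
  by rewrite LE.
exists (J^T *m G *m J).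
  split; first by rewrite !trmx_mul trmxK GT mulmxA.
  move=> v v0; rewrite bilE bil_congr; apply: pG.2; rewrite JE col_mx_eq0.
  by rewrite negb_and v0.
move=> x z u; set a := col_mx (sys_drift _ _ _) _; set b := col_mx (sysN _ *m _) _.
pose y := L *m col_mx x z.
rewrite !bil_congr (move_mid _ a (sys_drift S2 y u)).
have : bil G (J *m b) (J *m b)
    <= bil G (col_mx b (sysN S2 *m y)) (col_mx b (sysN S2 *m y)).
  set b2 := sysN S2 *m y; have -> : col_mx b b2 = J *m b + col_mx 0 (b2 - L *m b).
    by rewrite JE add_col_mx addr0 addrC subrK.
  set dlt := col_mx 0 _; rewrite bilDl !bilDr (bilC dlt _ GT) JE !LE addr0 add0r.
  by rewrite lerDl.
rewrite !JE -/y !GE !J1E !J2E => lebb.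
have {dV} := dV x y u; have {dW} := dW y z u.
set v1 := sysC S1 *m x; set v2 := sysC S2 *m y; set v3 := sysC S3 *m z.
have := sqnorm2D_weighted (v1 - v2) (v2 - v3) g0 h0; rewrite -/c -/e addrA subrK.
set q13 := sqnorm2 _; set q12 := sqnorm2 _; set q23 := sqnorm2 _.
move=> qle /(ler_wpM2l (ltW e0)) + /(ler_wpM2l (ltW c0)); rewrite !mulrBr !mulrDr.
have ce : c * (g ^+ 2 * sqnorm2 u) + e * (h ^+ 2 * sqnorm2 u)
          = (g + h) ^+ 2 * sqnorm2 u.
  by rewrite /c /e; field; rewrite !lt0r_neq0.
lra.
Qed.

(** Truncation to the range of a projection [P], kept at the original dimension
    so that all truncations share one state space. *)
Definition compress n m p (S : system n m p) (P : 'M[R]_n) : system n m p :=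
  System (P *m sysA S *m P) (P *m sysN S *m P) (P *m sysB S) (sysC S *m P).

(** For a projection commuting with W, the range and the kernel are orthogonal. *)
Lemma quadform_proj_le n (W P : 'M[R]_n) v :
  (forall x, 0 <= bil W x x) -> W^T = W -> P^T = P -> P *m P = P -> P *m W = W *m P ->
  bil W (P *m v) (P *m v) <= bil W v v.
Proof.
move=> W0 WT PT PP PW.
have -> : bil W v v = bil W (P *m v) (P *m v)
                      + bil W (v - P *m v) (v - P *m v).
  rewrite bilDr !bilDl !bilNr !bilNl !bilMl !bilMr PT PW -!mulmxA PP; ring.
by rewrite lerDl.
Qed.

(** With z = P x - Q y and s = P x + Q y, the storage function is the sum of
    <z, S z> and sg^2 <s, S^-1 s>.  Truncation perturbs the drift of z by
    h = (P - Q)(A Q y + B u) and that of s by - h.  Since S is the scalar sg on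
    the removed block, where z and s agree, the two contributions cancel.  The
    perturbations g and - g of the noise leave - 2 sg |g|^2 <= 0.  What remains
    is bounded by the two Lyapunov inequalities: the first gives - |C z|^2, and
    the second absorbs the input term up to 4 sg^2 |u|^2.  The form must also be
    definite off the ranges of P and Q, where nothing moves; this is what the
    summands with K and K' are for. *)
Lemma truncation_step n m p (F : system n m p) (S P Q : 'M[R]_n) (sg : R) :
  0 < sg -> posdefmx S ->
  P^T = P -> P *m P = P -> Q^T = Q -> Q *m Q = Q -> P *m Q = Q -> Q *m P = Q ->
  P *m S = S *m P -> Q *m S = S *m Q -> (P - Q) *m S = sg *: (P - Q) ->
  (forall v, 2 * bil S v (sysA F *m v) + bil S (sysN F *m v) (sysN F *m v)
     <= - sqnorm2 (sysC F *m v)) ->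
  (forall v, 2 * bil (invmx S) v (sysA F *m v)
     + bil (invmx S) (sysN F *m v) (sysN F *m v)
     <= - sqnorm2 ((sysB F)^T *m invmx S *m v)) ->
  exists2 W : 'M[R]_(n + n), posdefmx W &
    dissipation (compress F P) (compress F Q) (2 * sg) W.
Proof.
case: F => A N B C /= sg0 pS PT PP QT QQ PQ QP PS QS ES obs ctr.
have Su := posdef_unitmx pS; have pSi := posdef_invmx pS.
set Si := invmx S in pSi ctr *.
have ST := pS.1; have SiT := pSi.1.
have inv_comm M : M *m S = S *m M -> M *m Si = Si *m M.
  by move=> MS; apply: (can_inj (mulmxK Su)); rewrite mulmxKV// -mulmxA MS mulKmx.
have PSi := inv_comm _ PS; have QSi := inv_comm _ QS.
have sgn0 := lt0r_neq0 sg0.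
have ESi : (P - Q) *m Si = sg^-1 *: (P - Q).
  apply: (can_inj (mulmxK Su)); rewrite mulmxKV// -scalemxAl ES scalerA mulVf//.
  by rewrite scale1r.
pose Z : 'M[R]_(n, n + n) := row_mx P (- Q).
pose Z' : 'M[R]_(n, n + n) := row_mx P Q.
pose K : 'M[R]_(n, n + n) := row_mx (1%:M - P) 0.
pose K' : 'M[R]_(n, n + n) := row_mx 0 (1%:M - Q).
pose W := Z^T *m S *m Z + sg ^+ 2 *: (Z'^T *m Si *m Z')
          + (K^T *m 1%:M *m K + K'^T *m 1%:M *m K').
have WE v w : bil W v w =
    bil S (Z *m v) (Z *m w) + sg ^+ 2 * bil Si (Z' *m v) (Z' *m w)
    + (bil 1%:M (K *m v) (K *m w) + bil 1%:M (K' *m v) (K' *m w)).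
  by rewrite 3!bil_addmx bil_scalemx !bil_congr.
have ZE x y : Z *m col_mx x y = P *m x - Q *m y :> 'cV[R]_n.
  by rewrite mul_row_col mulNmx.
have Z'E x y : Z' *m col_mx x y = P *m x + Q *m y :> 'cV[R]_n.
  by rewrite mul_row_col.
have KE x y : K *m col_mx x y = x - P *m x :> 'cV[R]_n.
  by rewrite mul_row_col mul0mx addr0 mulmxBl mul1mx.
have K'E x y : K' *m col_mx x y = y - Q *m y :> 'cV[R]_n.
  by rewrite mul_row_col mul0mx add0r mulmxBl mul1mx.
exists W.
  split.
    rewrite !linearD linearZ/= !trmx_mul !trmxK ST SiT trmx1.
    by rewrite !mulmxA.
  move=> v; apply: contra_neqT; rewrite -leNgt bilE WE -!sqnorm2E => le0.
  have hS := posdef_ge0 pS (Z *m v); have hSi := posdef_ge0 pSi (Z' *m v).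
  have hK := sqnorm2_ge0 (K *m v); have hK' := sqnorm2_ge0 (K' *m v).
  have sg2 : 0 < sg ^+ 2 by rewrite exprn_gt0.
  have hSi' := mulr_ge0 (ltW sg2) hSi.
  have /(posdef_eq0 pS) : bil S (Z *m v) (Z *m v) <= 0 by lra.
  have /(posdef_eq0 pSi) : bil Si (Z' *m v) (Z' *m v) <= 0.
    by rewrite -(pmulr_rle0 _ sg2); lra.
  have /sqnorm2_eq0 : sqnorm2 (K *m v) = 0 by lra.
  have /sqnorm2_eq0 : sqnorm2 (K' *m v) = 0 by lra.
  rewrite -(vsubmxK v) ZE Z'E KE K'E.
  set x := usubmx v; set y := dsubmx v.
  move=> /eqP; rewrite subr_eq0 => /eqP Qy /eqP; rewrite subr_eq0 => /eqP Px.
  rewrite -Qy -Px => /eqP; rewrite addr_eq0 => /eqP -> /eqP.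
  rewrite -opprD oppr_eq0 -mulr2n -scaler_nat scaler_eq0 pnatr_eq0/= => /eqP ->.
  by rewrite oppr0 col_mx0.
move=> x y u; rewrite /sys_drift/= !WE !KE !K'E !ZE !Z'E.
have -> : P *m (P *m A *m P *m x + P *m B *m u) = P *m A *m P *m x + P *m B *m u.
  by rewrite mulmxDr !mulmxA PP.
have -> : Q *m (Q *m A *m Q *m y + Q *m B *m u) = Q *m A *m Q *m y + Q *m B *m u.
  by rewrite mulmxDr !mulmxA QQ.
rewrite !mulmxA PP QQ !subrr !bil0r !addr0.
set z := P *m x - Q *m y; set s := P *m x + Q *m y.
pose E := P - Q.
have ET : E^T = E by rewrite linearB/= PT QT.
have EE : E *m E = E by rewrite mulmxBl !mulmxBr PP PQ QP QQ subrr subr0.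
have EP : E *m P = E by rewrite mulmxBl PP QP.
have PE : P *m E = E by rewrite mulmxBr PP PQ.
have EQ : E *m Q = 0 by rewrite mulmxBl PQ QQ subrr.
pose h := E *m (A *m (Q *m y) + B *m u).
pose g := E *m (N *m (Q *m y)).
have Pz : P *m z = z by rewrite mulmxBr !mulmxA PP PQ.
have Ps : P *m s = s by rewrite mulmxDr !mulmxA PP PQ.
have drift_sub : P *m A *m P *m x + P *m B *m u - (Q *m A *m Q *m y + Q *m B *m u)
          = P *m (A *m z) + h.
  rewrite /h /z /E !mulmxBl !(mulmxDr, mulmxN) !mulmxA.
  move: (P *m A *m P *m x) (P *m B *m u) (Q *m A *m Q *m y) (Q *m B *m u).
  move: (P *m A *m Q *m y) => a1 a2 a3 a4 a5.
  by apply/matrixP => i j; rewrite !mxE; ring.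
have drift_add : P *m A *m P *m x + P *m B *m u + (Q *m A *m Q *m y + Q *m B *m u)
          = P *m (A *m s) + 2 *: (P *m (B *m u)) - h.
  rewrite /h /s /E !mulmxBl !(mulmxDr, mulmxN) !mulmxA.
  move: (P *m A *m P *m x) (P *m B *m u) (Q *m A *m Q *m y) (Q *m B *m u).
  move: (P *m A *m Q *m y) => a1 a2 a3 a4 a5.
  by apply/matrixP => i j; rewrite !mxE; ring.
have noise_sub : P *m N *m P *m x - Q *m N *m Q *m y = P *m (N *m z) + g.
  rewrite /g /z /E !mulmxBl !(mulmxDr, mulmxN) !mulmxA.
  move: (P *m N *m P *m x) (Q *m N *m Q *m y) (P *m N *m Q *m y) => a1 a2 a3.
  by apply/matrixP => i j; rewrite !mxE; ring.
have noise_add : P *m N *m P *m x + Q *m N *m Q *m y = P *m (N *m s) - g.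
  rewrite /g /s /E !mulmxBl !(mulmxDr, mulmxN) !mulmxA.
  move: (P *m N *m P *m x) (Q *m N *m Q *m y) (P *m N *m Q *m y) => a1 a2 a3.
  by apply/matrixP => i j; rewrite !mxE; ring.
have out_sub : C *m P *m x - C *m Q *m y = C *m z by rewrite mulmxBr !mulmxA.
rewrite drift_sub drift_add noise_sub noise_add out_sub.
have Pl (M : 'M[R]_n) v w : P *m M = M *m P -> bil M v (P *m w) = bil M (P *m v) w.
  by move=> PM; rewrite bilMl PT PM bilMr.
have SE v w : bil S v (E *m w) = sg * bil 1%:M v (E *m w).
  have ES' : S *m E = E *m S by rewrite mulmxBl mulmxBr PS QS.
  by rewrite bilMr ES' ES bil_scalemx bilMr mul1mx.
have SiE v w : bil Si v (E *m w) = sg^-1 * bil 1%:M v (E *m w).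
  have ES' : Si *m E = E *m Si by rewrite mulmxBl mulmxBr PSi QSi.
  by rewrite bilMr ES' ESi bil_scalemx bilMr mul1mx.
have QE : Q *m E = 0 by rewrite mulmxBr QP QQ subrr.
have sE : s = z + 2 *: (Q *m y).
  by rewrite /s /z; apply/matrixP => i j; rewrite !mxE; ring.
have szE v : bil 1%:M s (E *m v) = bil 1%:M z (E *m v).
  have h0 : bil 1%:M (Q *m y) (E *m v) = 0.
    by rewrite bilMl QT mulmx1 bilMr QE /bil mulmx0 mul0mx mxE.
  by rewrite sE bilDl (bil1C (2 *: _)) bilZr (bil1C (E *m v) (Q *m y)) h0 mulr0 addr0.
have PEl v w : bil 1%:M (P *m v) (E *m w) = bil 1%:M v (E *m w).
  by rewrite bilMl PT mulmx1 bilMr PE bilMr mul1mx.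
have gE : bil 1%:M (N *m (Q *m y)) g = bil 1%:M g g.
  have EEl v : bil 1%:M (E *m v) (E *m v) = bil 1%:M v (E *m v).
    by rewrite bilMl ET mulmx1 bilMr EE bilMr mul1mx.
  by rewrite /g EEl.
have NsE : bil 1%:M (N *m s) g = bil 1%:M (N *m z) g + 2 * bil 1%:M g g.
  rewrite -gE sE mulmxDr -scalemxAr bilDl; congr (_ + _).
  by rewrite bil1C bilZr bil1C.
(* dropping the outer projection P in front of N only increases the form *)
have noise1 : bil S (P *m (N *m z) + g) (P *m (N *m z) + g) <=
    bil S (N *m z) (N *m z) + 2 * sg * bil 1%:M (N *m z) g + sg * bil 1%:M g g.
  have le1 := quadform_proj_le (N *m z) (posdef_ge0 pS) ST PT PP PS.
  rewrite bilDl !bilDr (bilC g _ ST) /g !SE PEl -/g; lra.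
have noise2 : bil Si (P *m (N *m s) - g) (P *m (N *m s) - g) <=
    bil Si (N *m s) (N *m s) - 2 * (sg^-1 * bil 1%:M (N *m s) g)
    + sg^-1 * bil 1%:M g g.
  have le1 := quadform_proj_le (N *m s) (posdef_ge0 pSi) SiT PT PP PSi.
  rewrite bilDl !bilDr !bilNl !bilNr (bilC g _ SiT) /g !SiE PEl -/g; lra.
move: (bil S (_ + g) _) noise1 => T1 noise1.
move: (bil Si (_ - g) _) noise2 => T2 noise2.
rewrite !bilDr bilNr bilZr (Pl S)// !(Pl Si)// Pz Ps /h SE SiE szE.
set zh := bil 1%:M z _.
have := obs z; have := ctr s; rewrite -/Si.
set q := B^T *m Si *m s => ctrs obsz.
have BuE : bil Si s (B *m u) = bil 1%:M q u.
  by rewrite /q /bil !trmx_mul trmxK SiT mulmx1 !mulmxA.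
(* Young's inequality 4 <q, u> <= |q|^2 + 4 |u|^2 yields the constant 2 sg *)
have young : 4 * bil 1%:M q u <= sqnorm2 q + 4 * sqnorm2 u.
  have := sqnorm2_ge0 (q - 2 *: u).
  rewrite !sqnorm2E bilDl !bilDr !bilNl !bilNr (bil1C (2 *: u) q) !bilZr.
  by rewrite (bil1C (2 *: u) u) bilZr; lra.
have g_ge0 : 0 <= bil 1%:M g g by rewrite -sqnorm2E sqnorm2_ge0.
have sg2 : 0 <= sg ^+ 2 by rewrite sqr_ge0.
have sgV (c : R) : sg ^+ 2 * (sg^-1 * c) = sg * c by field.
have noise2' := ler_wpM2l sg2 noise2.
have ctrs' := ler_wpM2l sg2 ctrs.
have young' := ler_wpM2l sg2 young.
have sgg : 0 <= sg * bil 1%:M g g by rewrite mulr_ge0// ltW.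
rewrite BuE; move: noise2'; rewrite NsE !(mulrDr, mulrN).
rewrite !(mulrCA (sg ^+ 2) 2) !sgV.
move: ctrs' young'; rewrite !(mulrDr, mulrN) exprMn.
lra.
Qed.

End Dissipation.

(** * Removing the blocks one at a time *)

Section TruncationStorage.
Context {R : realType}.

Definition bdiag k (mult : 'I_k -> nat) (c : 'I_k -> R) :
  'M[R]_(\sum_(i < k) mult i) := \mxdiag_(i < k) (c i)%:M.

Lemma mul_bdiag k (mult : 'I_k -> nat) (c e : 'I_k -> R) :
  bdiag mult c *m bdiag mult e = bdiag mult (fun i => c i * e i).
Proof.
rewrite /bdiag {2 3}/mxdiag mul_mxdiag_mxblock; apply: eq_mxblock => i j.
case: eqVneq => [->|_]; last by rewrite mulmx0.
by rewrite !conform_mx_id -scalar_mxM.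
Qed.

(** The coordinates of the retained part and of the first [j] removed blocks. *)
Definition keep n1 k (mult : 'I_k -> nat) (j : nat) :
    'M[R]_(n1 + \sum_(i < k) mult i) :=
  block_mx 1%:M 0 0 (bdiag mult (fun i => (i < j)%:R)).

Lemma keep_tr n1 k (mult : 'I_k -> nat) j : (keep n1 mult j)^T = keep n1 mult j.
Proof.
rewrite tr_block_mx !trmx0 trmx1 /bdiag tr_mxdiag.
by congr block_mx; apply: eq_mxdiag => i; rewrite tr_scalar_mx.
Qed.

Lemma mul_keep n1 k (mult : 'I_k -> nat) i j :
  keep n1 mult i *m keep n1 mult j = keep n1 mult (minn i j).
Proof.
rewrite mulmx_block !mulmx0 !mul0mx mulmx1 !add0r !addr0 mul_bdiag.
by congr block_mx; apply: eq_mxdiag => l; rewrite -natrM mulnb leq_min.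
Qed.

Lemma keep_all n1 k (mult : 'I_k -> nat) : keep n1 mult k = 1%:M.
Proof.
rewrite /keep /bdiag; under eq_mxdiag do rewrite ltn_ord.
by rewrite mxdiagZ -scalar_mx_block.
Qed.

Lemma keep0 n1 k (mult : 'I_k -> nat) : keep n1 mult 0 = block_mx 1%:M 0 0 0.
Proof.
rewrite /keep /bdiag; under eq_mxdiag do rewrite ltn0.
by rewrite mxdiagZ raddf0.
Qed.

Section chain.
Variables (n1 k m p : nat) (mult : 'I_k -> nat) (sigma : 'I_k -> R).
Let n := (n1 + \sum_(i < k) mult i)%N.
Variables (F : system (R := R) n m p) (S1 : 'M[R]_n1).
Let S : 'M[R]_n := block_mx S1 0 0 (bdiag mult sigma).
Hypothesis sigma_gt0 : forall i, 0 < sigma i.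
Hypothesis pS : posdefmx S.
Hypothesis obs : forall v,
  2 * bil S v (sysA F *m v) + bil S (sysN F *m v) (sysN F *m v)
     <= - sqnorm2 (sysC F *m v).
Hypothesis ctr : forall v, 2 * bil (invmx S) v (sysA F *m v)
     + bil (invmx S) (sysN F *m v) (sysN F *m v)
     <= - sqnorm2 ((sysB F)^T *m invmx S *m v).

Let keepS j : keep n1 mult j *m S = S *m keep n1 mult j.
Proof.
rewrite !mulmx_block !mulmx0 !mul0mx mulmx1 mul1mx !add0r !addr0 !mul_bdiag.
by congr block_mx; apply: eq_mxdiag => i; rewrite mulrC.
Qed.

Let keepB (j : 'I_k) :
  (keep n1 mult j.+1 - keep n1 mult j) *m S
  = sigma j *: (keep n1 mult j.+1 - keep n1 mult j).
Proof.
have bdiagB c e : bdiag mult c - bdiag mult e = bdiag mult (fun i => c i - e i).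
  by rewrite /bdiag -mxdiagB; apply: eq_mxdiag => i; rewrite raddfB.
have bdiagZ (a : R) c : a *: bdiag mult c = bdiag mult (fun i => a * c i).
  by rewrite -mul_scalar_mx -(mxdiagZ (p_ := mult)) mul_bdiag.
rewrite !opp_block_mx !add_block_mx mulmx_block scale_block_mx.
rewrite !subrr !mulmx0 !mul0mx !scaler0 !add0r bdiagB mul_bdiag bdiagZ.
congr block_mx; apply: eq_mxdiag => i; congr (_%:M); rewrite mulrC ltnS leq_eqVlt.
have [ji|ji] := eqVneq (val i) (val j).
  by rewrite (val_inj ji) ltnn subr0 mulr1.
by rewrite /= subrr !mulr0.
Qed.

Let partial_sum j := \sum_(i < k | (i < j)%N) sigma i.

(** The gains 2 sigma_i of the successive steps add up by composition. *)
Lemma truncation_chain j : (j < k)%N ->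
  exists2 W : 'M[R]_(n + n), posdefmx W &
    dissipation (compress F (keep n1 mult j.+1)) (compress F (keep n1 mult 0))
      (2 * partial_sum j.+1) W.
Proof.
have step (i : 'I_k) : exists2 W : 'M[R]_(n + n), posdefmx W &
    dissipation (compress F (keep n1 mult i.+1)) (compress F (keep n1 mult i))
      (2 * sigma i) W.
  apply: (truncation_step (S := S)) => //; rewrite ?keep_tr ?mul_keep ?minnn//.
  - by rewrite (minn_idPr _).
  - by rewrite (minn_idPl _).
elim: j => [|j IHj] jk.
  have -> : partial_sum 1 = sigma (Ordinal jk).
    rewrite /partial_sum (big_pred1 (Ordinal jk))// => i.
    by rewrite /= ltnS leqn0.
  exact: step (Ordinal jk).
have [W pW dW] := IHj (ltnW jk); have [V pV dV] := step (Ordinal jk).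
have sum_gt0 : 0 < partial_sum j.+1.
  rewrite /partial_sum (bigD1 (Ordinal (ltnW jk)))//=.
  by rewrite ltr_wpDr// sumr_ge0// => i _; exact: ltW.
have -> : partial_sum j.+2 = sigma (Ordinal jk) + partial_sum j.+1.
  rewrite /partial_sum (bigD1 (Ordinal jk))/=; last exact: ltnSn.
  congr (_ + _); apply: eq_bigl => i.
  by rewrite -(inj_eq val_inj)/= ltnS (ltn_neqAle i) andbC.
rewrite mulrDr; apply: (dissipation_trans _ _ pV pW dV dW); exact: mulr_gt0.
Qed.

(** The truncated system lives in the coordinates of [S1] only; its storage
    function is read off by embedding its state with zeros. *)
Lemma truncation_storage :
  exists W : 'M[R]_(n + n1), [/\ W^T = W, forall v, 0 <= bil W v v &
    dissipation F (System (ulsubmx (sysA F)) (ulsubmx (sysN F)) (usubmx (sysB F))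
      (lsubmx (sysC F))) (2 * \sum_(i < k) sigma i) W].
Proof.
have [W [WT W0 dW]] : exists W : 'M[R]_(n + n), [/\ W^T = W,
    forall v, 0 <= bil W v v &
    dissipation F (compress F (keep n1 mult 0)) (2 * \sum_(i < k) sigma i) W].
  have Fall : compress F (keep n1 mult k) = F.
    by rewrite keep_all; case: (F) => *; rewrite /compress/= !(mul1mx, mulmx1).
  (* without removed blocks the bound is 0, which composition does not cover; the
     form x, y |-> <x - y, S (x - y)> is only semidefinite but suffices *)
  have [k0|k_gt0] := posnP k.
    have F0 : compress F (keep n1 mult 0) = F by rewrite -[in keep _ _ 0]k0.
    have sum0 : \sum_(i < k) sigma i = 0.
      by apply: big1 => i; have := ltn_ord i; rewrite {2}k0.
    rewrite F0 sum0.
    pose J : 'M[R]_(n, n + n) := row_mx 1%:M (- 1%:M).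
    have JE x y : J *m col_mx x y = x - y :> 'cV[R]_n.
      by rewrite mul_row_col mulNmx !mul1mx.
    exists (J^T *m S *m J); split.
    - by rewrite !trmx_mul trmxK pS.1 mulmxA.
    - by move=> v; rewrite bil_congr; exact: posdef_ge0.
    move=> x y u; rewrite !bil_congr !JE /sys_drift opprD addrACA subrr addr0 -!mulmxBr.
    apply: le_trans (obs _) _.
    by rewrite mulr0 expr0n mul0r sub0r.
  have k1 : (k.-1 < k)%N by rewrite prednK.
  have [W pW] := truncation_chain k1; rewrite prednK// Fall => dW.
  exists W; split; [exact: pW.1|exact: posdef_ge0|].
  suff -> : \sum_(i < k) sigma i = partial_sum k by [].
  by apply: eq_bigl => i; rewrite ltn_ord.
pose J : 'M[R]_(n + n, n + n1) :=
  block_mx 1%:M 0 0 (col_mx 1%:M 0).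
have JE x y : J *m col_mx x y = col_mx x (col_mx y 0) :> 'cV[R]_(n + n).
  by rewrite mul_block_col mul_col_mx !mul0mx !mul1mx addr0 add0r.
have keep0E q (x : 'M[R]_(n, q)) : keep n1 mult 0 *m x = col_mx (usubmx x) 0.
  by rewrite keep0 -{1}(vsubmxK x) mul_block_col !mul0mx mul1mx !addr0.
have AE (M : 'M[R]_n) y :
    keep n1 mult 0 *m M *m keep n1 mult 0 *m col_mx y 0 = col_mx (ulsubmx M *m y) 0.
  rewrite -!mulmxA !keep0E col_mxKu -{1}(submxK M) mul_block_col !mulmx0 addr0.
  by rewrite col_mxKu.
exists (J^T *m W *m J); split.
- by rewrite !trmx_mul trmxK WT mulmxA.
- by move=> v; rewrite bil_congr.
move=> x y u; rewrite !bil_congr !JE /sys_drift/=.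
have := dW x (col_mx y 0) u; rewrite /sys_drift/= !AE.
have -> : keep n1 mult 0 *m sysB F *m u = col_mx (usubmx (sysB F) *m u) 0.
  by rewrite keep0E mul_col_mx mul0mx.
have -> : sysC F *m keep n1 mult 0 *m col_mx y 0 = lsubmx (sysC F) *m y.
  rewrite -mulmxA keep0E col_mxKu -{1}(hsubmxK (sysC F)) mul_row_col.
  by rewrite mulmx0 addr0.
by rewrite add_col_mx addr0.
Qed.
End chain.
End TruncationStorage.

(** * Square-integrable functions *)

Section SquareIntegrable.
Context d (T : measurableType d) (R : realType).
Variable mu : {measure set T -> \bar R}.
Implicit Types f g h : T -> R.

Definition sqint f :=
  measurable_fun setT f /\ (\int[mu]_x (f x ^+ 2)%:E < +oo)%E.

Definition ip f g : R := \int[mu]_x (f x * g x).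

Lemma sqint_integrable_mul f g : sqint f -> sqint g ->
  mu.-integrable setT (fun x => (f x * g x)%:E).
Proof.
move=> [mf f2] [mg g2]; apply/integrableP; split.
  by apply/measurable_EFinP/measurable_funM.
have mf2 : measurable_fun setT (fun x => (f x ^+ 2)%:E).
  by apply/measurable_EFinP/measurable_funX.
have mg2 : measurable_fun setT (fun x => (g x ^+ 2)%:E).
  by apply/measurable_EFinP/measurable_funX.
apply: (@le_lt_trans _ _ (\int[mu]_x ((f x ^+ 2)%:E + (g x ^+ 2)%:E))%E).
  apply: ge0_le_integral => //=.
  - by apply/measurable_EFinP; apply: measurableT_comp => //; exact: measurable_funM.
  - exact: emeasurable_funD.
  move=> x _; rewrite -EFinD lee_fin normrM -(real_normK (num_real (f x))).
  rewrite -(real_normK (num_real (g x))).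
  by have := sqr_ge0 (`|f x| - `|g x|); have := normr_ge0 (f x);
     have := normr_ge0 (g x); nra.
rewrite ge0_integralD//=; first exact: lte_add_pinfty.
- by move=> x _; rewrite lee_fin sqr_ge0.
- by move=> x _; rewrite lee_fin sqr_ge0.
Qed.

Lemma sqintD f g : sqint f -> sqint g -> sqint (fun x => f x + g x).
Proof.
move=> sf sg; split.
  by apply: measurable_funD; [case: sf|case: sg].
have If := sqint_integrable_mul sf sf; have Ig := sqint_integrable_mul sg sg.
have Ifg := sqint_integrable_mul sf sg.
have : mu.-integrable setT (fun x => ((f x + g x) ^+ 2)%:E).
  apply: (eq_integrable measurableT _ _ _
    (integrableD measurableT (integrableD measurableT If Ig)
      (integrableD measurableT Ifg Ifg))) => //= x _.
  by rewrite -!EFinD; congr EFin; ring.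
by move=> /(integrable_lty measurableT).
Qed.

Lemma sqintZ (c : R) f : sqint f -> sqint (fun x => c * f x).
Proof.
move=> sf; split.
  by apply: measurable_funM => //; case: sf.
have : mu.-integrable setT (fun x => ((c * f x) ^+ 2)%:E).
  apply: (eq_integrable measurableT _ _ _
    (integrableZl measurableT (c ^+ 2) (sqint_integrable_mul sf sf))) => //= x _.
  by rewrite -EFinM; congr EFin; ring.
by move=> /(integrable_lty measurableT).
Qed.

Lemma eq_sqint f g : f =1 g -> sqint f -> sqint g.
Proof. by move=> /funext ->. Qed.

Lemma sqintN f : sqint f -> sqint (fun x => - f x).
Proof. by move=> /(sqintZ (-1)); apply: eq_sqint => x; rewrite mulN1r. Qed.

Lemma sqintB f g : sqint f -> sqint g -> sqint (fun x => f x - g x).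
Proof. by move=> sf /sqintN; exact: sqintD. Qed.

Lemma sqint0 : sqint (fun=> 0).
Proof.
split; first exact: measurable_cst.
by under eq_integral do rewrite expr0n; rewrite integral0.
Qed.

Lemma sqint_sum I (s : seq I) (f_ : I -> T -> R) :
  (forall i, sqint (f_ i)) -> sqint (fun x => \sum_(i <- s) f_ i x).
Proof.
move=> sf; elim: s => [|i s IHs].
  by apply: eq_sqint sqint0 => x; rewrite big_nil.
by apply: eq_sqint (sqintD (sf i) IHs) => x; rewrite big_cons.
Qed.

Lemma ipC f g : ip f g = ip g f.
Proof. by apply: eq_Rintegral => x _; rewrite mulrC. Qed.

Lemma ipDl f g h : sqint f -> sqint g -> sqint h ->
  ip (fun x => f x + g x) h = ip f h + ip g h.
Proof.
move=> sf sg sh; rewrite /ip -RintegralD//; try exact: sqint_integrable_mul.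
by apply: eq_Rintegral => x _; rewrite mulrDl.
Qed.

Lemma ipZl c f h : sqint f -> sqint h -> ip (fun x => c * f x) h = c * ip f h.
Proof.
move=> sf sh; rewrite /ip -RintegralZl//; try exact: sqint_integrable_mul.
by apply: eq_Rintegral => x _; rewrite mulrA.
Qed.

Lemma ipBl f g h : sqint f -> sqint g -> sqint h ->
  ip (fun x => f x - g x) h = ip f h - ip g h.
Proof.
move=> sf sg sh; rewrite /ip -RintegralB//; try exact: sqint_integrable_mul.
by apply: eq_Rintegral => x _; rewrite mulrBl.
Qed.

Lemma ipDr f g h : sqint f -> sqint g -> sqint h ->
  ip h (fun x => f x + g x) = ip h f + ip h g.
Proof. by move=> sf sg sh; rewrite ipC ipDl// !(ipC h). Qed.

Lemma ipBr f g h : sqint f -> sqint g -> sqint h ->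
  ip h (fun x => f x - g x) = ip h f - ip h g.
Proof. by move=> sf sg sh; rewrite ipC ipBl// !(ipC h). Qed.

Lemma ipZr c f h : sqint f -> sqint h -> ip h (fun x => c * f x) = c * ip h f.
Proof. by move=> sf sh; rewrite ipC ipZl// (ipC h). Qed.

Lemma ip0l h : ip (fun=> 0) h = 0.
Proof.
rewrite /ip; under eq_Rintegral do rewrite mul0r.
by rewrite /Rintegral integral0.
Qed.

Lemma ip_suml I (s : seq I) (f_ : I -> T -> R) h :
  (forall i, sqint (f_ i)) -> sqint h ->
  ip (fun x => \sum_(i <- s) f_ i x) h = \sum_(i <- s) ip (f_ i) h.
Proof.
move=> sf sh; elim: s => [|i s IHs].
  by rewrite big_nil -[RHS](ip0l h); apply: eq_Rintegral => x _; rewrite big_nil.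
rewrite big_cons -IHs -ipDl//; last exact: sqint_sum.
by apply: eq_Rintegral => x _; rewrite big_cons.
Qed.

Lemma ip_ge0 f : 0 <= ip f f.
Proof. by apply: Rintegral_ge0 => x _; rewrite -expr2 sqr_ge0. Qed.

Lemma eq_ip f f' g g' : f =1 f' -> g =1 g' -> ip f g = ip f' g'.
Proof. by move=> ff gg; apply: eq_Rintegral => x _; rewrite ff gg. Qed.

Lemma sqint_bounded_mul (X Y : T -> R) (M : R) : measurable_fun setT X ->
  (forall om, `|X om| <= M) -> sqint Y -> sqint (fun om => X om * Y om).
Proof.
move=> mX XM sY; split; first by apply: measurable_funM => //; case: sY.
apply: le_lt_trans (sqintZ M sY).2; apply: ge0_le_integral => //.
- by move=> om _; rewrite lee_fin sqr_ge0.
- apply/measurable_EFinP; apply: measurable_funX; apply: measurable_funM => //.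
  by case: sY.
- by apply/measurable_EFinP; apply: measurable_funX; case: (sqintZ M sY).
move=> om _; rewrite lee_fin !exprMn ler_wpM2r ?sqr_ge0//.
by rewrite -real_normK ?num_real// ler_pXn2r ?nnegrE// (le_trans _ (XM om)).
Qed.

Lemma integrable_bounded_mul (c f : T -> R) : measurable_fun setT c ->
  (forall x, `|c x| <= 1) -> mu.-integrable setT (EFin \o f) ->
  mu.-integrable setT (fun x => (c x * f x)%:E).
Proof.
move=> mc c1 intf.
have mf : measurable_fun setT f by apply/measurable_EFinP; exact: measurable_int intf.
apply: le_integrable intf => //.
  by apply/measurable_EFinP; exact: measurable_funM.
by move=> x _; rewrite /= lee_fin normrM ler_piMl.
Qed.

Lemma ae_eq_Rintegral f g : measurable_fun setT f -> measurable_fun setT g ->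
  {ae mu, forall x, f x = g x} -> \int[mu]_x f x = \int[mu]_x g x.
Proof.
move=> mf mg fg; rewrite /Rintegral; congr fine.
apply: ae_eq_integral => //; try exact/measurable_EFinP.
by apply: filterS fg => x fgx _; rewrite fgx.
Qed.

Lemma ae_eq_ip f f' g : measurable_fun setT f -> measurable_fun setT f' ->
  measurable_fun setT g -> {ae mu, forall x, f x = f' x} -> ip f g = ip f' g.
Proof.
move=> mf mf' mg ff'; apply: ae_eq_Rintegral; try exact: measurable_funM.
by apply: filterS ff' => x ->.
Qed.

Lemma EFin_ip f g : sqint f -> sqint g ->
  (ip f g)%:E = (\int[mu]_x (f x * g x)%:E)%E.
Proof.
move=> sf sg; rewrite /ip /Rintegral fineK//.
by apply: integrable_fin_num => //; exact: sqint_integrable_mul.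
Qed.

Lemma EFin_ip_sqr f : sqint f -> (ip f f)%:E = (\int[mu]_x (f x ^+ 2)%:E)%E.
Proof.
by move=> sf; rewrite EFin_ip//; apply: eq_integral => x _; rewrite expr2.
Qed.

Lemma CauchySchwarz_ip f g : sqint f -> sqint g ->
  `|ip f g| <= Num.sqrt (ip f f) * Num.sqrt (ip g g).
Proof.
move=> sf sg; rewrite -sqrtrM ?ip_ge0// -sqrtr_sqr ler_wsqrtr//.
have quad c : 0 <= ip f f - 2 * c * ip f g + c ^+ 2 * ip g g.
  have := ip_ge0 (fun x => f x - c * g x).
  have scg := sqintZ c sg; have sfg := sqintB sf scg.
  rewrite ipBl// !ipBr// ipZr// !ipZl// ipZr// (ipC g f); lra.
have [g0|gn0] := eqVneq (ip g g) 0.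
  have : ip f g = 0.
    apply/eqP; apply: contraT => fg.
    (* at this point the quadratic would take the value - 1 *)
    have := quad ((ip f f + 1) / (2 * ip f g)).
    rewrite g0 mulr0 addr0; set t := ip f g in fg *.
    have -> : 2 * ((ip f f + 1) / (2 * t)) * t = ip f f + 1 by field.
    by rewrite opprD addrA subrr add0r ler0N1.
  by move=> ->; rewrite g0 mulr0 expr0n.
have g_gt0 : 0 < ip g g by rewrite lt0r gn0 ip_ge0.
have := quad (ip f g / ip g g); set t := ip f g; set v := ip g g in gn0 g_gt0 *.
rewrite -(pmulr_rge0 _ g_gt0).
have -> : v * (ip f f - 2 * (t / v) * t + (t / v) ^+ 2 * v) = ip f f * v - t ^+ 2.
  by field.
by rewrite subr_ge0.
Qed.

Lemma ip_sqD f g : sqint f -> sqint g ->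
  ip (fun x => f x + g x) (fun x => f x + g x) = ip f f + 2 * ip f g + ip g g.
Proof.
move=> sf sg; have sD := sqintD sf sg.
by rewrite ipDl// !ipDr// (ipC g f); ring.
Qed.

Lemma ip_bounded_mul_le (X Y : T -> R) (M : R) : measurable_fun setT X ->
  (forall om, `|X om| <= M) -> sqint Y ->
  ip (fun om => X om * Y om) (fun om => X om * Y om) <= M ^+ 2 * ip Y Y.
Proof.
move=> mX XM sY; have sXY := sqint_bounded_mul mX XM sY.
rewrite expr2 -mulrA -ipZr// -ipZl//; last exact: sqintZ.
have sMY := sqintZ M sY.
apply: le_Rintegral => //; try exact: sqint_integrable_mul.
move=> om _; rewrite -!expr2 !exprMn ler_wpM2r ?sqr_ge0//.
by rewrite -real_normK ?num_real// ler_pXn2r ?nnegrE// (le_trans _ (XM om)).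
Qed.

Definition L2cvg (f_ : nat -> T -> R) f :=
  ip (fun x => f_ k x - f x) (fun x => f_ k x - f x) @[k --> \oo] --> 0.

Lemma cvg_ip (f_ g_ : nat -> T -> R) f g : (forall k, sqint (f_ k)) -> sqint f ->
  (forall k, sqint (g_ k)) -> sqint g -> L2cvg f_ f -> L2cvg g_ g ->
  ip (f_ k) (g_ k) @[k --> \oo] --> ip f g.
Proof.
move=> sf_ sf sg_ sg cf cg.
pose a k := Num.sqrt (ip (fun x => f_ k x - f x) (fun x => f_ k x - f x)).
pose b k := Num.sqrt (ip (fun x => g_ k x - g x) (fun x => g_ k x - g x)).
have a0 : a k @[k --> \oo] --> 0.
  by rewrite -[X in _ --> X]sqrtr0; apply: continuous_cvg => //; exact: sqrt_continuous.
have b0 : b k @[k --> \oo] --> 0.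
  by rewrite -[X in _ --> X]sqrtr0; apply: continuous_cvg => //; exact: sqrt_continuous.
pose e k := a k * b k + a k * Num.sqrt (ip g g) + Num.sqrt (ip f f) * b k.
have e0 : e k @[k --> \oo] --> 0.
  rewrite -[X in _ --> X](_ : 0 * 0 + 0 * Num.sqrt (ip g g) + Num.sqrt (ip f f) * 0 = 0).
    by apply: cvgD; [apply: cvgD|]; apply: cvgM => //; exact: cvg_cst.
  by rewrite !(mul0r, mulr0, addr0).
apply/subr_cvg0; apply/norm_cvg0P.
apply: (squeeze_cvgr _ (cvg_cst 0) e0).
near=> k; rewrite normr_ge0/=.
have sdf := sqintB (sf_ k) sf; have sdg := sqintB (sg_ k) sg.
have -> : ip (f_ k) (g_ k) - ip f g =
    ip (fun x => f_ k x - f x) (fun x => g_ k x - g x)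
    + ip (fun x => f_ k x - f x) g + ip f (fun x => g_ k x - g x).
  by rewrite ipBl// !ipBr// ipBl//; ring.
apply: le_trans (ler_normD _ _) _; apply: lerD; last exact: CauchySchwarz_ip.
by apply: le_trans (ler_normD _ _) _; apply: lerD; exact: CauchySchwarz_ip.
Unshelve. all: by end_near. Qed.

Lemma L2cvg_cst f : L2cvg (fun=> f) f.
Proof.
rewrite /L2cvg (_ : (fun=> _) = cst 0); first exact: cvg_cst.
apply/funext => k; rewrite -[RHS](ip0l (fun x => f x - f x)).
by apply: eq_ip => x //; rewrite subrr.
Qed.

Lemma ip_add_sq f g : sqint f -> sqint g ->
  ip (fun x => f x + g x) (fun x => f x + g x) <= 2 * ip f f + 2 * ip g g.
Proof.
move=> sf sg; have := ip_ge0 (fun x => f x - g x).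
have sB := sqintB sf sg; have sD := sqintD sf sg.
by rewrite ipBl// !ipBr// ipDl// !ipDr// (ipC g f); lra.
Qed.

Lemma L2cvgD (f_ g_ : nat -> T -> R) f g : (forall k, sqint (f_ k)) -> sqint f ->
  (forall k, sqint (g_ k)) -> sqint g -> L2cvg f_ f -> L2cvg g_ g ->
  L2cvg (fun k x => f_ k x + g_ k x) (fun x => f x + g x).
Proof.
move=> sf_ sf sg_ sg cf cg.
have h0 : 2 * ip (fun x => f_ k x - f x) (fun x => f_ k x - f x)
   + 2 * ip (fun x => g_ k x - g x) (fun x => g_ k x - g x) @[k --> \oo] --> 0.
  rewrite -[X in _ --> X](_ : 2 * 0 + 2 * 0 = 0); last by rewrite mulr0 addr0.
  by apply: cvgD; apply: cvgM => //; exact: cvg_cst.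
apply: (squeeze_cvgr _ (cvg_cst 0) h0); near=> k; rewrite ip_ge0/=.
apply: le_trans (ip_add_sq (sqintB (sf_ k) sf) (sqintB (sg_ k) sg)).
by rewrite le_eqVlt; apply/orP; left; apply/eqP; apply: eq_ip => x; ring.
Unshelve. all: by end_near. Qed.

Lemma L2cvgZ c (f_ : nat -> T -> R) f : (forall k, sqint (f_ k)) -> sqint f -> L2cvg f_ f ->
  L2cvg (fun k x => c * f_ k x) (fun x => c * f x).
Proof.
move=> sf_ sf cf; rewrite /L2cvg.
have -> : (fun k => ip (fun x => c * f_ k x - c * f x) (fun x => c * f_ k x - c * f x))
   = (fun k => c ^+ 2 * ip (fun x => f_ k x - f x) (fun x => f_ k x - f x)).
  apply/funext => k; have sB := sqintB (sf_ k) sf; have sZ := sqintZ c sB.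
  rewrite expr2 -mulrA -ipZr// -ipZl//.
  by apply: eq_ip => x; rewrite mulrBr.
rewrite -[X in _ --> X](mulr0 (c ^+ 2)); apply: cvgM => //; exact: cvg_cst.
Qed.

End SquareIntegrable.

(** * Products of independent variables *)

Section Independence.
Context d (Omega : measurableType d) (R : realType) (P : probability Omega R).
Implicit Types X Y : Omega -> R.

(** The hypothesis says that the joint law of (X, Y) is the product of the
    marginal laws, so the expectation of the product factors by Fubini. *)
Lemma expectation_mul_indep X Y :
  (forall A B : set R, measurable A -> measurable B ->
    P (X @^-1` A `&` Y @^-1` B) = (P (X @^-1` A) * P (Y @^-1` B))%E) ->
  P.-integrable setT (EFin \o X) -> P.-integrable setT (EFin \o Y) ->
  P.-integrable setT (fun om => (X om * Y om)%:E) /\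
  \int[P]_om (X om * Y om) = (\int[P]_om X om) * (\int[P]_om Y om).
Proof.
move=> indep iX iY.
have mX : measurable_fun setT X by apply/measurable_EFinP; exact: measurable_int iX.
have mY : measurable_fun setT Y by apply/measurable_EFinP; exact: measurable_int iY.
pose X' : {mfun Omega >-> R} := HB.pack X (isMeasurableFun.Build _ _ _ _ X mX).
pose Y' : {mfun Omega >-> R} := HB.pack Y (isMeasurableFun.Build _ _ _ _ Y mY).
pose XY om := (X om, Y om).
have mXY : measurable_fun setT XY by exact/measurable_fun_pairP.
pose XY' : {mfun Omega >-> (R * R)%type} :=
  HB.pack XY (isMeasurableFun.Build _ _ _ _ XY mXY).
pose mX' := distribution P X'; pose mY' := distribution P Y'.
have law A : measurable A -> (mX' \x mY')%E A = distribution P XY' A.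
  by apply: product_measure_unique => B C mB mC; rewrite -indep.
have iabs Z : P.-integrable setT (EFin \o Z) ->
    (\int[P]_om `|Z om|%:E < +oo)%E /\ (0 <= \int[P]_om `|Z om|%:E)%E.
  by move=> /integrableP[_ iZ]; split => //; exact: integral_ge0.
have [X_lty X_ge0] := iabs _ iX; have [Y_lty Y_ge0] := iabs _ iY.
have mprod : measurable_fun setT (fun z : R * R => (z.1 * z.2)%:E).
  by apply/measurable_EFinP; apply: measurable_funM;
    [exact: measurable_fst|exact: measurable_snd].
have intprod : (mX' \x mY')%E.-integrable setT (fun z => (z.1 * z.2)%:E).
  apply/integrable12ltyP => //.
  under eq_integral => x _.
    under eq_integral do rewrite /= normrM EFinM.
    rewrite ge0_integralZl//; last first.
      by apply/measurable_EFinP; exact: normr_measurable.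
    rewrite ge0_integral_distribution//; last first.
      by apply/measurable_EFinP; exact: normr_measurable.
    over.
  rewrite ge0_integralZr//; last first.
    by apply/measurable_EFinP; exact: normr_measurable.
  rewrite ge0_integral_distribution//; last first.
    by apply/measurable_EFinP; exact: normr_measurable.
  by rewrite lte_mul_pinfty// ge0_fin_numE.
have iXY : P.-integrable setT (fun om => (X om * Y om)%:E).
  apply/integrableP; split.
    by apply/measurable_EFinP; exact: measurable_funM.
  have /integrableP[_] := intprod.
  rewrite (eq_measure_integral (distribution P XY')); last by move=> A mA _; exact: law.
  by rewrite ge0_integral_distribution//; exact: measurableT_comp.
split => //; rewrite /Rintegral -fineM; last 2 first.
- exact: integrable_fin_num.
- exact: integrable_fin_num.
congr fine.
transitivity (\int[distribution P XY']_z (z.1 * z.2)%:E)%E.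
  by rewrite integral_distribution.
rewrite -(eq_measure_integral (distribution P XY') (m1 := (mX' \x mY')%E)); last first.
  by move=> A mA _; exact: law.
rewrite -integral12_prod_meas1//=.
have fX : (\int[P]_om (X om)%:E)%E \is a fin_num by exact: integrable_fin_num iX.
have fY : (\int[P]_om (Y om)%:E)%E \is a fin_num by exact: integrable_fin_num iY.
have iY' : mY'.-integrable setT (fun y => y%:E).
  apply/integrableP; split; first exact/measurable_EFinP.
  rewrite ge0_integral_distribution//.
  by apply/measurable_EFinP; exact: normr_measurable.
have iX' : mX'.-integrable setT (fun y => y%:E).
  apply/integrableP; split; first exact/measurable_EFinP.
  rewrite ge0_integral_distribution//.
  by apply/measurable_EFinP; exact: normr_measurable.
under eq_integral => x _.
  rewrite /fubini_F/=; under eq_integral do rewrite EFinM.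
  rewrite integralZl// integral_distribution//=.
  rewrite -(fineK fY).
  over.
by rewrite integralZr//= integral_distribution//= fineK.
Qed.

End Independence.

(** * Mean and variance of the centred Gaussian law *)

Section GaussianMoments.
Context (R : realType).
Variable s : R.
Hypothesis s_gt0 : 0 < s.
Local Notation N := (normal_prob 0 s).
Local Notation leb := (@lebesgue_measure R).
Local Notation g := (normal_fun 0 s).

(** The Gaussian density is a Radon-Nikodym derivative, and these are unique
    almost everywhere. *)
Lemma integral_normal_density (f : R -> \bar R) : measurable_fun setT f ->
  (forall x, 0 <= f x)%E ->
  (\int[N]_x f x = \int[leb]_x (f x * (normal_pdf 0 s x)%:E))%E.
Proof.
move=> mf f0; have dom := normal_prob_dominates 0 s.
rewrite -(Radon_Nikodym_SigmaFinite.change_of_variables dom)//.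
have iRN := Radon_Nikodym_SigmaFinite.f_integrable dom.
apply: ae_eq_integral => //.
- by apply: emeasurable_funM => //; exact: measurable_int iRN.
- by apply: emeasurable_funM => //; apply/measurable_EFinP; exact: measurable_normal_pdf.
apply: ae_eqe_mul2l; apply: integral_ae_eq => //.
- by apply/measurable_EFinP; exact: measurable_normal_pdf.
- by move=> E _ mE; rewrite -Radon_Nikodym_SigmaFinite.f_integral.
Qed.

Let normal_funE x : g x = expR (- (x ^+ 2 / (s ^+ 2 *+ 2))).
Proof. by rewrite /normal_fun subr0 mulNr. Qed.

Let v_gt0 : 0 < s ^+ 2 *+ 2.
Proof. by rewrite mulrn_wgt0// exprn_gt0. Qed.

Let cvg_normal_fun : g x @[x --> +oo] --> 0.
Proof.
under eq_fun do rewrite normal_funE.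
apply: (cvg_comp (fun x => x ^+ 2 / (s ^+ 2 *+ 2)) (fun x => expR (- x))).
  apply: gt0_cvgMly; first by rewrite invr_gt0.
  exact: cvgr_expr2.
exact: cvgr_expR.
Qed.

Let is_derive_primitive (x : R) :
  is_derive x 1 (fun y : R => - (s ^+ 2 * g y) : R) (x * g x).
Proof.
have dh : is_derive x 1 (fun y : R => - (y ^+ 2 / (s ^+ 2 *+ 2)) : R)
    (- (x / s ^+ 2)).
  have -> : (fun y : R => - (y ^+ 2 / (s ^+ 2 *+ 2)) : R) =
      (- (s ^+ 2 *+ 2)^-1) *: ((id : R -> R) ^+ 2).
    by apply/funext => y; rewrite fctE /= mulrC -mulNr.
  apply: is_derive_eq; rewrite /GRing.scale/= expr1 mulr1.
  by field; rewrite lt0r_neq0.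
have -> : (fun y : R => - (s ^+ 2 * g y) : R) =
    (- s ^+ 2) *: (expR \o (fun y => - (y ^+ 2 / (s ^+ 2 *+ 2)))).
  by apply/funext => y; rewrite normal_funE fctE /= -mulNr.
apply: is_derive_eq; rewrite /GRing.scale/= normal_funE.
by field; rewrite lt0r_neq0.
Qed.

Let continuous_normal_fun : continuous g.
Proof.
have -> : g = (fun x => (- s ^+ 2)^-1 * (- (s ^+ 2 * g x))).
  by apply/funext => x; field; rewrite lt0r_neq0.
move=> x; apply: cvgM; first exact: cvg_cst.
by case: (is_derive_primitive x) => /derivable1_diffP/differentiable_continuous.
Qed.

Let normal_fun_tail y : 0 <= y ->
  (\int[leb]_(x in `[y, +oo[) (x * g x)%:E = (s ^+ 2 * g y)%:E)%E.
Proof.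
move=> y0; rewrite (@ge0_continuous_FTC2y _ _ (fun y => - (s ^+ 2 * g y)) _ 0).
- by rewrite sub0e -EFinN opprK.
- by move=> x yx; rewrite mulr_ge0 ?normal_fun_ge0// (le_trans y0).
- apply: continuous_subspaceT => x; apply: cvgM; first exact: cvg_id.
  exact: continuous_normal_fun.
- rewrite [X in _ --> X](_ : 0 = - (s ^+ 2 * 0)); last by rewrite mulr0 oppr0.
  apply: cvgN; apply: cvgM.
    exact: cvg_cst.
  exact: cvg_normal_fun.
- by move=> x _; case: (is_derive_primitive x).
- apply: cvg_at_right_filter; apply: cvgN; apply: cvgM; first exact: cvg_cst.
  exact: continuous_normal_fun.
- move=> x _; rewrite derive1E; exact: derive_val.
Qed.

(** Tonelli: write x^2 g(x) as the integral over y in [0, x] of x g(x), and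
    integrate first over x >= y, where x g(x) has the primitive - s^2 g. *)
Let normal_fun_half_moment :
  (\int[leb]_(x in `[0%R, +oo[) (x ^+ 2 * g x)%:E
   = (s ^+ 2)%:E * \int[leb]_(x in `[0%R, +oo[) (g x)%:E)%E.
Proof.
pose h (z : R * R) : \bar R :=
  ((\1_`[0, +oo[ z.2 * \1_`[0, +oo[ (z.1 - z.2)) * (z.1 * g z.1))%:E.
have mh : measurable_fun setT h.
  apply/measurable_EFinP; apply: measurable_funM; last first.
    apply: measurable_funM; first exact: measurable_fst.
    by apply: measurableT_comp; [exact: measurable_normal_fun|exact: measurable_fst].
  apply: measurable_funM; first by apply: measurableT_comp => //; exact: measurable_snd.
  apply: measurableT_comp => //; apply: measurable_funB.
    exact: measurable_fst.
  exact: measurable_snd.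
have hE x y : h (x, y) = (if 0 <= y <= x then x * g x else 0)%:E.
  rewrite /h !indicE !mem_setE/= !in_itv/= !andbT subr_ge0.
  by case: (0 <= y) => /=; case: (y <= x) => /=; rewrite ?(mul1r, mulr0, mul0r).
have h0 z : (0 <= h z)%E.
  case: z => x y; rewrite hE lee_fin; case: ifPn => // /andP[y0 yx].
  by rewrite mulr_ge0 ?normal_fun_ge0// (le_trans y0).
have := @fubini_tonelli _ _ _ _ R leb leb h mh h0.
rewrite /fubini_F /fubini_G.
have -> : (\int[leb]_x \int[leb]_y h (x, y)
    = \int[leb]_(x in `[0%R, +oo[) (x ^+ 2 * g x)%:E)%E.
  rewrite [RHS]integral_mkcond; apply: eq_integral => x _.
  rewrite patchE mem_setE in_itv/= andbT.
  transitivity (\int[leb]_(y in `[0%R, x]) (x * g x)%:E)%E.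
    rewrite [RHS]integral_mkcond; apply: eq_integral => y _.
    by rewrite hE patchE mem_setE in_itv/=; case: ifP.
  rewrite integral_cst//= lebesgue_measure_itv/= lte_fin.
  case: ltP => [x_gt0|x_le0].
    by rewrite (ltW x_gt0) oppr0 adde0 -EFinM; congr EFin; ring.
  rewrite mule0; case: ifPn => // x_ge0.
  have -> : x = 0 by apply/le_anti; rewrite x_le0.
  by rewrite expr0n mul0r.
move=> ->.
rewrite -ge0_integralZl//; last 3 first.
- by apply/measurable_EFinP; exact: measurable_funTS (measurable_normal_fun _ _).
- by move=> x _; rewrite lee_fin normal_fun_ge0.
- by rewrite lee_fin sqr_ge0.
rewrite [RHS]integral_mkcond; apply: eq_integral => y _.
rewrite patchE mem_setE in_itv/= andbT; case: ifPn => y0.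
  rewrite -EFinM -normal_fun_tail// [RHS]integral_mkcond; apply: eq_integral => x _.
  by rewrite hE patchE mem_setE in_itv/= andbT y0/=; case: ifP.
rewrite -[RHS](integral0 leb setT); apply: eq_integral => x _.
by rewrite hE (negbTE y0).
Qed.

Let setcy : [set x : R | 0 <= x] = `[0, +oo[%classic.
Proof. by apply/seteqP; split => x /=; rewrite in_itv/= andbT. Qed.

Lemma normal_prob_second_moment : (\int[N]_x (x ^+ 2)%:E = (s ^+ 2)%:E)%E.
Proof.
have sn0 := lt0r_neq0 s_gt0.
rewrite integral_normal_density; last 2 first.
- by apply/measurable_EFinP; exact: measurable_funX.
- by move=> x; rewrite lee_fin sqr_ge0.
have pdfE x : normal_pdf 0 s x = normal_peak s * g x by rewrite normal_pdfE.
have even_g x : g x = g (- x) by rewrite !normal_funE sqrrN.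
under eq_integral do rewrite -EFinM pdfE mulrCA EFinM.
rewrite ge0_integralZl//; last 3 first.
- apply/measurable_EFinP; apply: measurable_funM; first exact: measurable_funX.
  exact: measurable_normal_fun.
- by move=> x _; rewrite lee_fin mulr_ge0 ?sqr_ge0 ?normal_fun_ge0.
- by rewrite lee_fin normal_peak_ge0.
rewrite ge0_symfun_integralT; last 3 first.
- by move=> x; rewrite mulr_ge0 ?sqr_ge0 ?normal_fun_ge0.
- move=> x; apply: cvgM; last exact: continuous_normal_fun.
  exact: exprn_continuous.
- by move=> x /=; rewrite sqrrN -even_g.
rewrite setcy normal_fun_half_moment (muleCA 2%:E) -setcy.
rewrite -ge0_symfun_integralT; last 3 first.
- by move=> x; exact: normal_fun_ge0.
- exact: continuous_normal_fun.
- exact: even_g.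
rewrite muleCA -ge0_integralZl//; last 3 first.
- apply/measurable_EFinP; exact: measurable_normal_fun.
- by move=> x _; rewrite lee_fin normal_fun_ge0.
- by rewrite lee_fin normal_peak_ge0.
have <- : (\int[leb]_x (normal_pdf 0 s x)%:E
    = \int[leb]_x ((normal_peak s)%:E * (g x)%:E))%E.
  by apply: eq_integral => x _; rewrite pdfE.
by rewrite integral_normal_pdf mule1.
Qed.

Lemma integrable_normal_prob_id : N.-integrable setT (fun x => x%:E).
Proof.
have i1 : N.-integrable setT (EFin \o cst 1) by exact: finite_measure_integrable_cst.
have i2 : N.-integrable setT (fun x => (x ^+ 2)%:E).
  apply/integrableP; split; first by apply/measurable_EFinP; exact: measurable_funX.
  under eq_integral do rewrite /= ger0_norm ?sqr_ge0//.
  by rewrite normal_prob_second_moment ltry.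
have i12 := integrableD measurableT i1 i2.
apply: le_integrable i12 => //; first exact/measurable_EFinP.
move=> x _ /=; rewrite lee_fin [leRHS]ger0_norm ?addr_ge0 ?sqr_ge0//.
rewrite -(real_normK (num_real x)).
by have := normr_ge0 x; have := sqr_ge0 (`|x| - 1); nra.
Qed.

(** By symmetry, the positive and the negative part of the identity have the
    same integral. *)
Lemma normal_prob_mean : \int[N]_x x = 0.
Proof.
rewrite /Rintegral integralE.
suff -> : (\int[N]_x (EFin^\- x) = \int[N]_x (EFin^\+ x))%E.
  rewrite subee//; apply: integrable_pos_fin_num => //.
  exact: integrable_normal_prob_id.
have mid : measurable_fun setT (EFin : R -> \bar R) by apply/measurable_EFinP.
rewrite !integral_normal_density//; last 2 first.
- exact: measurable_funepos.
- exact: measurable_funeneg.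
pose opp : measurableTypeR R -> measurableTypeR R := -%R.
have mopp : measurable_fun setT opp by exact: oppr_measurable.
pose f (x : measurableTypeR R) := (EFin^\+ x * (normal_pdf 0 s x)%:E)%E.
have mf : measurable_fun setT f.
  apply: emeasurable_funM; first exact: measurable_funepos.
  by apply/measurable_EFinP; exact: measurable_normal_pdf.
transitivity (\int[leb]_(x in opp @^-1` setT) (f \o opp) x)%E.
  rewrite preimage_setT; apply: eq_integral => x _; rewrite /f/=; congr (_ * _)%E.
    by rewrite funenegE funeposE EFinN.
  by rewrite !normal_pdfE ?lt0r_neq0// /normal_fun !subr0 sqrrN.
rewrite -(ge0_integral_pushforward mopp)//; last first.
  by move=> x _; rewrite /f mule_ge0 ?funepos_ge0// lee_fin normal_pdf_ge0.
by apply: eq_measure_integral => A mA _; exact: lebesgue_measureN.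
Qed.

End GaussianMoments.

(** * Adapted variables and Wiener increments *)

Section MeasurableWrt.
Context (R : realType) (d : measure_display) (Omega : measurableType d).
Implicit Types (G : set (set Omega)) (X Y : Omega -> R).

(** Through the measurable type generated by G, the closure properties of
    measurable functions become available for G. *)
Lemma measurable_wrtE G X : sigma_algebra setT G ->
  measurable_wrt G X <-> measurable_fun (setT : set (g_sigma_algebraType G)) X.
Proof.
move=> sG; have GE : @measurable _ (g_sigma_algebraType G) = G.
  exact: sigma_algebra_id.
split => [mX _ Y mY|mX Y mY].
  by rewrite setTI GE; exact: mX.
by have := mX measurableT Y mY; rewrite setTI GE.
Qed.

Lemma measurable_wrtD G X Y : sigma_algebra setT G ->
  measurable_wrt G X -> measurable_wrt G Y ->
  measurable_wrt G (fun om => X om + Y om).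
Proof.
move=> sG /(measurable_wrtE _ sG) mX /(measurable_wrtE _ sG) mY.
by apply/(measurable_wrtE _ sG); exact: measurable_funD.
Qed.

Lemma measurable_wrtM G X Y : sigma_algebra setT G ->
  measurable_wrt G X -> measurable_wrt G Y ->
  measurable_wrt G (fun om => X om * Y om).
Proof.
move=> sG /(measurable_wrtE _ sG) mX /(measurable_wrtE _ sG) mY.
by apply/(measurable_wrtE _ sG); exact: measurable_funM.
Qed.

Lemma measurable_wrt_cst G (c : R) : sigma_algebra setT G ->
  measurable_wrt G (fun=> c).
Proof. by move=> sG; apply/(measurable_wrtE _ sG). Qed.

Lemma measurable_wrtB G X Y : sigma_algebra setT G ->
  measurable_wrt G X -> measurable_wrt G Y ->
  measurable_wrt G (fun om => X om - Y om).
Proof.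
move=> sG /(measurable_wrtE _ sG) mX /(measurable_wrtE _ sG) mY.
by apply/(measurable_wrtE _ sG); exact: measurable_funB.
Qed.

Lemma measurable_wrt_sum G I (s : seq I) (X_ : I -> Omega -> R) :
  sigma_algebra setT G -> (forall i, measurable_wrt G (X_ i)) ->
  measurable_wrt G (fun om => \sum_(i <- s) X_ i om).
Proof.
move=> sG mX; apply/(measurable_wrtE _ sG); apply: measurable_sum => i.
exact/(measurable_wrtE _ sG).
Qed.

Lemma measurable_wrt_sub G G' X : G `<=` G' -> measurable_wrt G X -> measurable_wrt G' X.
Proof. by move=> GG' mX Y mY; exact/GG'/mX. Qed.

Lemma measurable_wrt_fun G X : G `<=` measurable -> measurable_wrt G X ->
  measurable_fun setT X.
Proof. by move=> GM mX _ Y mY; rewrite setTI; exact/GM/mX. Qed.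

End MeasurableWrt.

Section WienerIncrements.
Context (R : realType) (d : measure_display) (Omega : measurableType d).
Variables (P : probability Omega R) (F : R -> set (set Omega)).
Variable w : R -> Omega -> R.
Hypotheses (hF : is_filtration F) (hw : is_wiener P F w).

Let sF t : 0 <= t -> sigma_algebra setT (F t). Proof. by case: hF => + _ _; exact. Qed.
Let FM t : 0 <= t -> F t `<=` measurable. Proof. by case: hF => _ + _; exact. Qed.
Let FF s t : 0 <= s -> s <= t -> F s `<=` F t. Proof. by case: hF => _ _; exact. Qed.
Let wF t : 0 <= t -> measurable_wrt (F t) (w t). Proof. by case: hw => + _ _ _ _; exact. Qed.

Lemma measurable_wiener t : 0 <= t -> measurable_fun setT (w t).
Proof. by move=> t0; apply: measurable_wrt_fun (wF t0); exact: FM. Qed.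

Definition incr s t om := w t om - w s om.

Let measurable_incr s t : 0 <= s -> s <= t -> measurable_fun setT (incr s t).
Proof.
by move=> s0 st; apply: measurable_funB; apply: measurable_wiener => //; exact: le_trans st.
Qed.

Lemma incr_adapted s t r : 0 <= s -> s <= t -> t <= r -> measurable_wrt (F r) (incr s t).
Proof.
move=> s0 st tr; apply: measurable_wrtB.
- by apply: sF; rewrite (le_trans s0)// (le_trans st).
- apply: measurable_wrt_sub (wF _); first by apply: FF => //; exact: le_trans st.
  exact: le_trans st.
- by apply: measurable_wrt_sub (wF s0); apply: FF => //; exact: le_trans tr.
Qed.

Let incr_law s t (f : R -> R) : 0 <= s -> s < t -> measurable_fun setT f ->
  (normal_prob 0 (Num.sqrt (t - s))).-integrable setT (EFin \o f) ->
  P.-integrable setT (EFin \o (f \o incr s t)) /\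
  \int[P]_om f (incr s t om) = \int[normal_prob 0 (Num.sqrt (t - s))]_x f x.
Proof.
move=> s0 st mf intf.
have mX := measurable_incr s0 (ltW st).
pose X' : {mfun Omega >-> measurableTypeR R} :=
  HB.pack (incr s t : Omega -> measurableTypeR R)
    (isMeasurableFun.Build _ _ _ (measurableTypeR R) _ mX).
have law A : measurable A -> distribution P X' A = normal_prob 0 (Num.sqrt (t - s)) A.
  by move=> mA; case: hw => _ _ /(_ s t s0 st A mA) + _ _.
have intX : P.-integrable setT (EFin \o (f \o incr s t)).
  apply/integrableP; split.
    by apply/measurable_EFinP; exact: measurableT_comp.
  have /integrableP[_] := intf.
  rewrite (eq_measure_integral (distribution P X')); last first.
    by move=> A mA _; exact/esym/law.
  rewrite ge0_integral_distribution//.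
  by apply/measurable_EFinP; exact: measurableT_comp.
split => //; rewrite /Rintegral; congr fine.
rewrite [in RHS](eq_measure_integral (distribution P X')); last first.
  by move=> A mA _; exact/esym/law.
by rewrite integral_distribution//; exact/measurable_EFinP.
Qed.

Let sqrt_gt0 s t : s < t -> 0 < Num.sqrt (t - s) :> R.
Proof. by move=> st; rewrite sqrtr_gt0 subr_gt0. Qed.

Let incr_indep s t (f : R -> R) (X : Omega -> R) : 0 <= s -> s < t ->
  measurable_fun setT f -> measurable_wrt (F s) X ->
  forall A B : set R, measurable A -> measurable B ->
    P (X @^-1` A `&` (f \o incr s t) @^-1` B)
    = (P (X @^-1` A) * P ((f \o incr s t) @^-1` B))%E.
Proof.
move=> s0 st mf mX A B mA mB.
case: hw => _ _ _ /(_ s t s0 st (X @^-1` A) (f @^-1` B) (mX A mA)) + _.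
by apply; rewrite -[X in measurable X]setTI; exact: mf.
Qed.

(** The increment after s is centred and independent of F s. *)
Lemma expectation_mul_incr s t (X : Omega -> R) : 0 <= s -> s <= t ->
  measurable_wrt (F s) X -> P.-integrable setT (EFin \o X) ->
  \int[P]_om (X om * incr s t om) = 0.
Proof.
move=> s0 + mX iX; rewrite le_eqVlt => /predU1P[->|st].
  rewrite /Rintegral [X in fine X](_ : _ = 0%E)//.
  by apply: integral0_eq => om _; rewrite /incr subrr mulr0.
have iN := integrable_normal_prob_id (sqrt_gt0 st).
have [iI EI] := incr_law s0 st (@measurable_id _ _ _) iN.
have [_ ->] := expectation_mul_indep (incr_indep s0 st (@measurable_id _ _ _) mX) iX iI.
by rewrite EI normal_prob_mean ?mulr0//; exact: sqrt_gt0.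
Qed.

Lemma expectation_mul_incr_sqr s t (X : Omega -> R) : 0 <= s -> s <= t ->
  measurable_wrt (F s) X -> P.-integrable setT (EFin \o X) ->
  P.-integrable setT (fun om => (X om * incr s t om ^+ 2)%:E) /\
  \int[P]_om (X om * incr s t om ^+ 2) = (t - s) * \int[P]_om X om.
Proof.
move=> s0 + mX iX; rewrite le_eqVlt => /predU1P[->|st].
  rewrite subrr mul0r; under eq_fun do rewrite /incr subrr expr0n mulr0.
  split; first exact: integrable0.
  rewrite /Rintegral [X in fine X](_ : _ = 0%E)//.
  by apply: integral0_eq => om _; rewrite /incr subrr expr0n mulr0.
have msqr : measurable_fun setT (fun x : R => x ^+ 2) by exact: measurable_funX.
have N2 := normal_prob_second_moment (sqrt_gt0 st).
have iN : (normal_prob 0 (Num.sqrt (t - s))).-integrable setT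
    (EFin \o (fun x => x ^+ 2)).
  apply/integrableP; split; first exact/measurable_EFinP.
  by under eq_integral do rewrite /= ger0_norm ?sqr_ge0//; rewrite N2 ltry.
have [iI EI] := incr_law s0 st msqr iN.
have [iXI ->] := expectation_mul_indep (incr_indep s0 st msqr mX) iX iI.
split => //; rewrite EI /Rintegral N2/= sqr_sqrtr ?subr_ge0 ?(ltW st)//.
exact: mulrC.
Qed.

Lemma sqint_cst (c : R) : sqint P (fun=> c).
Proof.
split; first exact: measurable_cst.
rewrite integral_cst//= probability_setT mule1; exact: ltry.
Qed.

Lemma sqint_incr s t : 0 <= s -> s <= t -> sqint P (incr s t).
Proof.
move=> s0 st; split; first exact: measurable_incr.
have i1 : P.-integrable setT (EFin \o cst (1 : R)).
  exact: finite_measure_integrable_cst.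
have [+ _] := expectation_mul_incr_sqr s0 st (measurable_wrt_cst 1 (sF s0)) i1.
by move=> /(integrable_lty measurableT); under eq_integral do rewrite mul1r.
Qed.

Definition bounded_adapted s (X : Omega -> R) :=
  measurable_wrt (F s) X /\ exists M : R, forall om, `|X om| <= M.

Lemma sqint_bounded_incr r s t X : 0 <= r -> r <= s -> s <= t -> bounded_adapted r X ->
  sqint P (fun om => X om * incr s t om).
Proof.
move=> r0 rs st [mX [M XM]]; apply: (@sqint_bounded_mul _ _ _ P _ _ M) => //.
  by apply: measurable_wrt_fun mX; exact: FM.
by apply: sqint_incr => //; exact: le_trans rs.
Qed.

(** The martingale property of the increments, tested against adapted
    square-integrable variables. *)
Lemma ip_adapted_incr s t (X Y : Omega -> R) : 0 <= s -> s <= t ->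
  measurable_wrt (F s) Y -> sqint P Y -> bounded_adapted s X ->
  ip P Y (fun om => X om * incr s t om) = 0.
Proof.
move=> s0 st mY sY [mX [M XM]].
have sX : sqint P X.
  apply: eq_sqint (@sqint_bounded_mul _ _ _ P X (fun=> 1) M _ XM (sqint_cst 1)).
    by move=> om; rewrite mulr1.
  by apply: measurable_wrt_fun mX; exact: FM.
rewrite /ip -(expectation_mul_incr s0 st (measurable_wrtM (sF s0) mY mX)).
  by apply: eq_Rintegral => om _; rewrite mulrA.
exact: sqint_integrable_mul.
Qed.

End WienerIncrements.

(** * Simple integrands and the Ito isometry *)

Section SimpleIntegrals.
Context (R : realType) (d : measure_display) (Omega : measurableType d).
Variables (P : probability Omega R) (F : R -> set (set Omega)).
Variable w : R -> Omega -> R.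
Hypotheses (hF : is_filtration F) (hw : is_wiener P F w).
Local Notation leb := (@lebesgue_measure R).
Local Notation mu := (leb \x P)%E.

Let sF t : 0 <= t -> sigma_algebra setT (F t). Proof. by case: hF => + _ _; exact. Qed.
Let FM t : 0 <= t -> F t `<=` measurable. Proof. by case: hF => _ + _; exact. Qed.
Let FF s t : 0 <= s -> s <= t -> F s `<=` F t. Proof. by case: hF => _ _; exact. Qed.

Let bounded_sub s t (X : Omega -> R) : 0 <= s -> s <= t ->
  bounded_adapted F s X -> bounded_adapted F t X.
Proof.
by move=> s0 st [mX bX]; split => //; apply: measurable_wrt_sub mX; exact: FF.
Qed.

Let incr_split r s t (om : Omega) : incr w r t om = incr w r s om + incr w s t om.
Proof. by rewrite /incr; ring. Qed.

Lemma bounded_adapted_sqint s (X : Omega -> R) : 0 <= s ->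
  bounded_adapted F s X -> sqint P X.
Proof.
move=> s0 [mX [M XM]].
apply: eq_sqint (sqint_bounded_mul _ XM (sqint_cst P 1)).
  by move=> om; rewrite mulr1.
by apply: measurable_wrt_fun mX; exact: FM.
Qed.

(** Ito isometry for two intervals: only the overlap contributes. *)
Lemma ip_incr_incr a b c e (X Y : Omega -> R) : 0 <= a -> a <= b -> 0 <= c -> c <= e ->
  bounded_adapted F a X -> bounded_adapted F c Y ->
  ip P (fun om => X om * incr w a b om) (fun om => Y om * incr w c e om)
  = Num.max 0 (Num.min b e - Num.max a c) * ip P X Y.
Proof.
move=> a0 ab c0 ce bX bY.
wlog ac : a b c e X Y a0 ab c0 ce bX bY / a <= c.
  move=> H; have /orP[ac|ca] := le_total a c; first exact: H.
  by rewrite ipC H// (ipC P Y) (minC e) (maxC c).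
rewrite (max_r ac); have bXc := bounded_sub a0 ac bX.
have adapted_mul s r t (Z : Omega -> R) : 0 <= s -> s <= r -> r <= t ->
    bounded_adapted F s Z -> measurable_wrt (F t) (fun om => Z om * incr w s r om).
  move=> s0 sr rt [mZ _]; apply: measurable_wrtM.
  - by apply: sF; rewrite (le_trans s0)// (le_trans sr).
  - by apply: measurable_wrt_sub mZ; apply: FF => //; exact: le_trans rt.
  - exact: (incr_adapted hF hw).
have sq := sqint_bounded_incr hF hw.
have orth := ip_adapted_incr hF hw.
have [bc|cb] := leP b c.
  rewrite max_l; last by rewrite subr_le0 ge_min bc.
  by rewrite mul0r; apply: orth => //; [exact: adapted_mul|exact: (sq a)].
(* cut both intervals at c and at m, so that they share ]c, m]; every other
   product of increments has disjoint intervals *)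
set m := Num.min b e.
have cm : c <= m by rewrite le_min (ltW cb).
have mb : m <= b by rewrite ge_min lexx.
have me : m <= e by rewrite ge_min lexx orbT.
have m0 : 0 <= m by exact: le_trans cm.
have bXm := bounded_sub c0 cm bXc; have bYm := bounded_sub c0 cm bY.
rewrite max_r ?subr_ge0//.
have s1 : sqint P (fun om => X om * incr w a c om) by exact: (sq a).
have s2 : sqint P (fun om => X om * incr w c m om) by exact: (sq c).
have s3 : sqint P (fun om => X om * incr w m b om) by exact: (sq m).
have t2 : sqint P (fun om => Y om * incr w c m om) by exact: (sq c).
have t3 : sqint P (fun om => Y om * incr w m e om) by exact: (sq m).
transitivity (ip P (fun om => X om * incr w a c om +
    (X om * incr w c m om + X om * incr w m b om))
  (fun om => Y om * incr w c m om + Y om * incr w m e om)).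
  apply: eq_ip => om.
    by rewrite (incr_split a c) (incr_split c m b) !mulrDr.
  by rewrite (incr_split c m) mulrDr.
have s23 := sqintD s2 s3; have t23 := sqintD t2 t3.
rewrite ipDl// ipDl// !(ipDr t2 t3)//.
have -> : ip P (fun om => X om * incr w a c om) (fun om => Y om * incr w c m om) = 0.
  by apply: orth => //; exact: adapted_mul.
have -> : ip P (fun om => X om * incr w a c om) (fun om => Y om * incr w m e om) = 0.
  by apply: orth => //; exact: adapted_mul.
have -> : ip P (fun om => X om * incr w c m om) (fun om => Y om * incr w m e om) = 0.
  by apply: orth => //; exact: adapted_mul.
have -> : ip P (fun om => X om * incr w m b om) (fun om => Y om * incr w c m om) = 0.
  by rewrite ipC; apply: orth => //; exact: adapted_mul.
have -> : ip P (fun om => X om * incr w m b om) (fun om => Y om * incr w m e om) = 0.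
  have [be|/ltW eb] := leP b e.
    rewrite -[RHS](ip0l P (fun om => Y om * incr w m e om)).
    by apply: eq_ip => // om; rewrite /m (min_l be) /incr subrr mulr0.
  rewrite ipC -[RHS](ip0l P (fun om => X om * incr w m b om)).
  by apply: eq_ip => // om; rewrite /m (min_r eb) /incr subrr mulr0.
rewrite !add0r !addr0.
have mXY := measurable_wrtM (sF c0) bXc.1 bY.1.
have iXY := sqint_integrable_mul (bounded_adapted_sqint a0 bX) (bounded_adapted_sqint c0 bY).
have [_ <-] := expectation_mul_incr_sqr hF hw c0 cm mXY iXY.
by apply: eq_Rintegral => om _; rewrite /incr; ring.
Qed.

(** Restriction of a process to [0, t], extended by zero to the whole product
    space so that Fubini's theorem applies to it directly. *)
Definition cutoff t (v : R -> Omega -> R) (z : measurableTypeR R * Omega) : R :=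
  if 0 <= z.1 <= t then v z.1 z.2 else 0.

(** A summand of a simple process: [pc_coef] on the interval ]pc_left, pc_right]. *)
Record piece := Piece {
  pc_left : R; pc_right : R; pc_coef : Omega -> R;
  pc_left_ge0 : 0 <= pc_left; pc_le : pc_left <= pc_right;
  pc_adapted : bounded_adapted F pc_left pc_coef }.

Definition piece_val (p : piece) t om : R :=
  if pc_left p < t <= pc_right p then pc_coef p om else 0.

Definition piece_int (p : piece) t om : R :=
  pc_coef p om * incr w (Num.min (pc_left p) t) (Num.min (pc_right p) t) om.

Let indic_mul (l h : R) (X : Omega -> R) : P.-integrable setT (EFin \o X) ->
  mu.-integrable setT (fun z => (\1_(`]l, h]%classic : set (measurableTypeR R)) z.1 * X z.2)%:E)
  /\ \int[mu]_z (\1_(`]l, h]%classic : set (measurableTypeR R)) z.1 * X z.2)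
     = Num.max 0 (h - l) * \int[P]_om X om.
Proof.
move=> iX; have mX : measurable_fun setT X by apply/measurable_EFinP; exact: measurable_int iX.
have /integrableP[_ X_lty] := iX.
pose I : set (measurableTypeR R) := `]l, h]%classic.
have mI : measurable I by exact: measurable_itv.
have lI : leb I = (Num.max 0 (h - l))%:E.
  rewrite /I lebesgue_measure_itv/= lte_fin; case: ltP => lh.
    by rewrite max_r ?subr_ge0 ?(ltW lh)// EFinB.
  by rewrite max_l// subr_le0.
have iI : (\int[leb]_x (\1_I x)%:E = (Num.max 0 (h - l))%:E)%E.
  by rewrite integral_indic// setIT; exact: lI.
have mz : measurable_fun setT (fun z : measurableTypeR R * Omega => (\1_I z.1 * X z.2)%:E).
  apply/measurable_EFinP; apply: measurable_funM.
    by apply: measurableT_comp => //; exact: measurable_fst.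
  by apply: measurableT_comp => //; exact: measurable_snd.
have iz : mu.-integrable setT (fun z => (\1_I z.1 * X z.2)%:E).
  apply/integrable12ltyP => //.
  under eq_integral => x _.
    under eq_integral do rewrite /= normrM EFinM.
    rewrite ge0_integralZl//; last first.
      by apply/measurable_EFinP; exact: measurableT_comp.
    rewrite ger0_norm//.
    over.
  rewrite ge0_integralZr//; last first.
  - by apply: integral_ge0.
  - by apply/measurable_EFinP.
  rewrite iI lte_mul_pinfty// ?lee_fin ?le_max ?lexx//.
split => //; rewrite /Rintegral -integral12_prod_meas1// /fubini_F/=.
under eq_integral => x _.
  under eq_integral do rewrite EFinM.
  rewrite integralZl//.
  rewrite -[X in (_ * X)%E](fineK (integrable_fin_num measurableT iX)).
  over.
rewrite integralZr//; last first.
  by apply/integrableP; split; [exact/measurable_EFinP|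
    under eq_integral do rewrite /= ger0_norm//; rewrite iI ltry].
by rewrite iI -EFinM.
Qed.

Let cutoff_pieceE p t z : cutoff t (piece_val p) z =
  \1_(`]pc_left p, Num.min (pc_right p) t]%classic : set (measurableTypeR R)) z.1 * pc_coef p z.2.
Proof.
rewrite /cutoff /piece_val indicE mem_setE in_itv/= le_min.
have := pc_left_ge0 p; have [lz /= p0|_ _] := ltP (pc_left p) z.1; last first.
  by rewrite mul0r; case: ifP.
rewrite (ltW (le_lt_trans p0 lz))/=; case: (z.1 <= t); case: (z.1 <= _);
by rewrite ?mul1r ?mul0r.
Qed.

Lemma sqint_cutoff_piece p t : sqint mu (cutoff t (piece_val p)).
Proof.
pose X om := pc_coef p om.
have sX : sqint P X by apply: bounded_adapted_sqint (pc_adapted p); exact: pc_left_ge0.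
split.
  rewrite (funext (cutoff_pieceE p t)); apply: measurable_funM.
    by apply: measurableT_comp; [exact: measurable_indic|exact: measurable_fst].
  by apply: measurableT_comp; [case: sX|exact: measurable_snd].
have [/(integrable_lty measurableT) + _] :=
  indic_mul (pc_left p) (Num.min (pc_right p) t) (sqint_integrable_mul sX sX).
congr (_ < _)%E; apply: eq_integral => z _; rewrite cutoff_pieceE; congr EFin.
by rewrite indicE; case: (_ \in _); rewrite ?mul1r ?mul0r ?expr0n// expr2.
Qed.

Lemma sqint_piece_int p t : 0 <= t -> sqint P (piece_int p t).
Proof.
move=> t0; have p0 := pc_left_ge0 p; have ple := pc_le p.
have [pt|tp] := leP (pc_left p) t.
  rewrite /piece_int min_l//; apply: (sqint_bounded_incr hF hw p0 (lexx _)).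
    by rewrite le_min ple.
  exact: pc_adapted.
apply: eq_sqint (sqint0 P) => om; rewrite /piece_int.
by rewrite !min_r ?(ltW tp) ?(le_trans (ltW tp))// /incr subrr mulr0.
Qed.

(** Both sides equal the length of the common part of the two intervals and of
    [0, t], times the expectation of the product of the coefficients. *)
Lemma piece_isometry p q t : 0 <= t ->
  ip P (piece_int p t) (piece_int q t)
  = ip mu (cutoff t (piece_val p)) (cutoff t (piece_val q)).
Proof.
move=> t0; have p0 := pc_left_ge0 p; have q0 := pc_left_ge0 q.
have ple := pc_le p; have qle := pc_le q.
have sX := bounded_adapted_sqint p0 (pc_adapted p).
have sY := bounded_adapted_sqint q0 (pc_adapted q).
transitivity (Num.max 0 (Num.min (Num.min (pc_right p) t) (Num.min (pc_right q) t)
    - Num.max (pc_left p) (pc_left q)) * ip P (pc_coef p) (pc_coef q)).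
  have [pt|tp] := leP (pc_left p) t; last first.
    rewrite max_l; last first.
      by rewrite subr_le0 !ge_min !le_max (ltW tp) !orbT.
    rewrite mul0r -[RHS](ip0l P (piece_int q t)).
    apply: eq_ip => // om; rewrite /piece_int.
    by rewrite !min_r ?(ltW tp) ?(le_trans (ltW tp))// /incr subrr mulr0.
  have [qt|tq] := leP (pc_left q) t; last first.
    rewrite max_l; last first.
      by rewrite subr_le0 !ge_min !le_max (ltW tq) !orbT.
    rewrite mul0r ipC -[RHS](ip0l P (piece_int p t)).
    apply: eq_ip => // om; rewrite /piece_int.
    by rewrite !min_r ?(ltW tq) ?(le_trans (ltW tq))// /incr subrr mulr0.
  rewrite /piece_int (min_l pt) (min_l qt) ip_incr_incr//.
  - by rewrite le_min ple.
  - by rewrite le_min qle.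
  - exact: pc_adapted.
  - exact: pc_adapted.
have [_ <-] := indic_mul (Num.max (pc_left p) (pc_left q))
  (Num.min (Num.min (pc_right p) t) (Num.min (pc_right q) t))
  (sqint_integrable_mul sX sY).
apply: eq_Rintegral => z _; rewrite !cutoff_pieceE !indicE !mem_setE !in_itv/=.
rewrite gt_max (le_min z.1).
by case: (_ < z.1); case: (_ < z.1); case: (z.1 <= _); case: (z.1 <= _);
   rewrite /= ?(mul1r, mul0r, mulr0).
Qed.

End SimpleIntegrals.

(** * The scalar Ito integral *)

Section ItoIntegral.
Context (R : realType) (d : measure_display) (Omega : measurableType d).
Variables (P : probability Omega R) (F : R -> set (set Omega)).
Variable w : R -> Omega -> R.
Hypotheses (hF : is_filtration F) (hw : is_wiener P F w).
Local Notation leb := (@lebesgue_measure R).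
Local Notation mu := (leb \x P)%E.

Let sF t : 0 <= t -> sigma_algebra setT (F t). Proof. by case: hF => + _ _; exact. Qed.
Let FF s t : 0 <= s -> s <= t -> F s `<=` F t. Proof. by case: hF => _ _; exact. Qed.

Definition pieces_val (S : seq (piece F)) t om := \sum_(p <- S) piece_val p t om.
Definition pieces_int (S : seq (piece F)) t om := \sum_(p <- S) piece_int w p t om.

Lemma cutoff_pieces_val S t z : cutoff t (pieces_val S) z = \sum_(p <- S) cutoff t (piece_val p) z.
Proof.
rewrite /cutoff /pieces_val; case: ifP => // _.
by rewrite big1.
Qed.

Lemma sqint_cutoff_pieces_val S t : sqint mu (cutoff t (pieces_val S)).
Proof.
rewrite (funext (cutoff_pieces_val S t)); apply: sqint_sum => p; exact: sqint_cutoff_piece.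
Qed.

Lemma sqint_pieces_int S t : 0 <= t -> sqint P (pieces_int S t).
Proof. by move=> t0; apply: sqint_sum => p; exact: (sqint_piece_int hF hw). Qed.

Lemma simple_isometry S S' t : 0 <= t ->
  ip P (pieces_int S t) (pieces_int S' t)
  = ip mu (cutoff t (pieces_val S)) (cutoff t (pieces_val S')).
Proof.
move=> t0; rewrite (funext (cutoff_pieces_val S t)) (funext (cutoff_pieces_val S' t)).
have sp p := sqint_piece_int hF hw p t0; have sc p := sqint_cutoff_piece P hF p t.
rewrite ip_suml//; last exact: sqint_pieces_int.
rewrite ip_suml//; last exact: sqint_sum.
apply: eq_bigr => p _; rewrite ipC ip_suml// [RHS]ipC ip_suml//.
by apply: eq_bigr => q _; rewrite ipC (piece_isometry hF hw)// ipC.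
Qed.

Lemma piece_martingale (p : piece F) s t (Y : Omega -> R) : 0 <= s -> s <= t ->
  measurable_wrt (F s) Y -> sqint P Y ->
  ip P Y (piece_int w p t) = ip P Y (piece_int w p s).
Proof.
move=> s0 st mY sY; have t0 := le_trans s0 st.
have p0 := pc_left_ge0 p; have ple := pc_le p.
have spt := sqint_piece_int hF hw p t0; have sps := sqint_piece_int hF hw p s0.
apply/eqP; rewrite -subr_eq0 -ipBr//; apply/eqP.
have orth a b : 0 <= a -> a <= b -> s <= a -> pc_left p <= a ->
    ip P Y (fun om => pc_coef p om * incr w a b om) = 0.
  move=> a0 ab sa pa; apply: (ip_adapted_incr hF hw) => //.
    by apply: measurable_wrt_sub mY; exact: FF.
  have [mX bX] := pc_adapted p; split => //.
  by apply: measurable_wrt_sub mX; exact: FF.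
have incrss r om : incr w r r om = 0 by rewrite /incr subrr.
have [bs|/ltW sb] := leP (pc_right p) s.
  rewrite -[RHS](ip0l P Y) ipC; apply: eq_ip => // om; rewrite /piece_int.
  have bt := le_trans bs st; rewrite (min_l bs) (min_l bt).
  by rewrite (min_l (le_trans ple bs)) (min_l (le_trans ple bt)) subrr.
have [ps|/ltW sp] := leP (pc_left p) s.
  rewrite -[RHS](orth s (Num.min (pc_right p) t))//; last by rewrite le_min sb.
  apply: eq_ip => // om; rewrite /piece_int (min_l ps) (min_l (le_trans ps st)).
  by rewrite (min_r sb) /incr; ring.
have [pt|/ltW tp] := leP (pc_left p) t.
  rewrite -[RHS](orth (pc_left p) (Num.min (pc_right p) t))//; last by rewrite le_min ple.
  apply: eq_ip => // om; rewrite /piece_int (min_r sp) (min_r sb) (min_l pt).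
  by rewrite incrss mulr0 subr0.
rewrite -[RHS](ip0l P Y) ipC; apply: eq_ip => // om; rewrite /piece_int.
rewrite (min_r sp) (min_r sb) (min_r tp) (min_r (le_trans tp ple)).
by rewrite !incrss subrr.
Qed.

Lemma pieces_martingale S s t (Y : Omega -> R) : 0 <= s -> s <= t ->
  measurable_wrt (F s) Y -> sqint P Y ->
  ip P Y (pieces_int S t) = ip P Y (pieces_int S s).
Proof.
move=> s0 st mY sY; have t0 := le_trans s0 st.
rewrite ipC ip_suml//; last by move=> p; exact: (sqint_piece_int hF hw).
rewrite [RHS]ipC ip_suml//; last by move=> p; exact: (sqint_piece_int hF hw).
by apply: eq_bigr => p _; rewrite ipC (piece_martingale p s0 st)// ipC.
Qed.

Lemma pieces_valD S S' t om :
  pieces_val (S ++ S') t om = pieces_val S t om + pieces_val S' t om.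
Proof. by rewrite /pieces_val big_cat. Qed.

Lemma pieces_intD S S' t om :
  pieces_int (S ++ S') t om = pieces_int S t om + pieces_int S' t om.
Proof. by rewrite /pieces_int big_cat. Qed.

Lemma bounded_adaptedZ s (c : R) (X : Omega -> R) : 0 <= s ->
  bounded_adapted F s X -> bounded_adapted F s (fun om => c * X om).
Proof.
move=> s0 [mX [M XM]]; split.
  exact: (measurable_wrtM (sF s0) (measurable_wrt_cst c (sF s0)) mX).
by exists (`|c| * M) => om; rewrite normrM ler_wpM2l.
Qed.

Definition scale_piece c (p : piece F) : piece F :=
  Piece (pc_left_ge0 p) (pc_le p) (bounded_adaptedZ c (pc_left_ge0 p) (pc_adapted p)).

Lemma pieces_valZ c S t om :
  pieces_val (map (scale_piece c) S) t om = c * pieces_val S t om.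
Proof.
rewrite /pieces_val big_map mulr_sumr; apply: eq_bigr => p _.
by rewrite /piece_val/=; case: ifP; rewrite ?mulr0.
Qed.

Lemma pieces_intZ c S t om :
  pieces_int (map (scale_piece c) S) t om = c * pieces_int S t om.
Proof.
rewrite /pieces_int big_map mulr_sumr; apply: eq_bigr => p _.
by rewrite /piece_int/= mulrA.
Qed.

(** The scalar Ito integral, with arbitrary finite families of pieces instead of
    partitions: these can be concatenated, so that sums of integrals are
    integrals without passing to a common refinement. *)
Definition ito_integral (f : R -> Omega -> R) t (Z : Omega -> R) :=
  [/\ sqint mu (cutoff t f), sqint P Z &
    exists S : nat -> seq (piece F),
      L2cvg mu (fun k => cutoff t (pieces_val (S k))) (cutoff t f) /\
      L2cvg P (fun k => pieces_int (S k) t) Z].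

Lemma cutoffD t (f g : R -> Omega -> R) z :
  cutoff t (fun s om => f s om + g s om) z = cutoff t f z + cutoff t g z.
Proof. by rewrite /cutoff; case: ifP; rewrite ?addr0. Qed.

Lemma cutoffB t (f g : R -> Omega -> R) z :
  cutoff t (fun s om => f s om - g s om) z = cutoff t f z - cutoff t g z.
Proof. by rewrite /cutoff; case: ifP; rewrite ?subr0. Qed.

Lemma cutoffZ t c (f : R -> Omega -> R) z :
  cutoff t (fun s om => c * f s om) z = c * cutoff t f z.
Proof. by rewrite /cutoff; case: ifP; rewrite ?mulr0. Qed.

Lemma ito_integralD f g t Y Z : 0 <= t -> ito_integral f t Y -> ito_integral g t Z ->
  ito_integral (fun s om => f s om + g s om) t (fun om => Y om + Z om).
Proof.
move=> t0 [sf sY [S [Sf SY]]] [sg sZ [S' [Sg SZ]]]; split.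
- by rewrite (funext (cutoffD t f g)); exact: sqintD.
- exact: sqintD.
exists (fun k => S k ++ S' k); split.
  rewrite (funext (cutoffD t f g)).
  rewrite (_ : (fun k => _) = (fun k z => cutoff t (pieces_val (S k)) z
    + cutoff t (pieces_val (S' k)) z)).
    by apply: L2cvgD => // k; exact: sqint_cutoff_pieces_val.
  apply/funext => k; apply/funext => z; rewrite -cutoffD /cutoff.
  by rewrite pieces_valD.
rewrite (_ : (fun k => _) = (fun k om => pieces_int (S k) t om
    + pieces_int (S' k) t om)).
  by apply: L2cvgD => // k; exact: sqint_pieces_int.
by apply/funext => k; apply/funext => om; rewrite pieces_intD.
Qed.

Lemma ito_isometry f t Z : 0 <= t -> ito_integral f t Z ->
  ip P Z Z = ip mu (cutoff t f) (cutoff t f).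
Proof.
move=> t0 [sf sZ [S [Sf SZ]]].
have sS k := sqint_cutoff_pieces_val (S k) t; have sI k := sqint_pieces_int (S k) t0.
have h1 := cvg_ip sS sf sS sf Sf Sf; have h2 := cvg_ip sI sZ sI sZ SZ SZ.
move: h2; under eq_fun do rewrite simple_isometry//; move=> h2.
exact: (cvg_unique _ h2 h1).
Qed.

Lemma sqint_cutoff_le s t (f : R -> Omega -> R) : s <= t ->
  sqint mu (cutoff t f) -> sqint mu (cutoff s f) /\
  ip mu (cutoff s f) (cutoff s f) <= ip mu (cutoff t f) (cutoff t f).
Proof.
move=> st sf.
pose I : set (measurableTypeR R) := `[0, s]%classic.
have fE z : cutoff s f z = \1_I z.1 * cutoff t f z.
  rewrite /cutoff indicE mem_setE in_itv/=.
  case: ifPn => [/andP[z0 zs]|]; last by rewrite mul0r.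
  by rewrite z0 (le_trans zs st) mul1r.
have mI : measurable_fun setT (fun z : measurableTypeR R * Omega => \1_I z.1 : R).
  apply: measurableT_comp; last exact: measurable_fst.
  by apply: measurable_indic; exact: measurable_itv.
have I1 (z : measurableTypeR R * Omega) : `|\1_I z.1 : R| <= 1.
  by rewrite indicE; case: (_ \in _); rewrite ?normr1 ?normr0.
rewrite (funext fE); split; first exact: (sqint_bounded_mul mI I1).
by apply: le_trans (ip_bounded_mul_le mI I1 sf) _; rewrite expr1n mul1r.
Qed.

(** The approximating families for t and for s need not be related.  But on
    [0, s] both approximate f, so by the isometry their integrals up to s have
    the same limit, and for simple integrands the martingale property is clear. *)
Lemma ito_martingale f s t Zs Zt (Y : Omega -> R) : 0 <= s -> s <= t ->
  ito_integral f s Zs -> ito_integral f t Zt ->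
  measurable_wrt (F s) Y -> sqint P Y -> ip P Y Zt = ip P Y Zs.
Proof.
move=> s0 st [sfs sZs [S [Sf SZ]]] [sft sZt [S' [Sf' SZ']]] mY sY.
have t0 := le_trans s0 st.
have sI k := sqint_pieces_int (S k) s0; have sI' k := sqint_pieces_int (S' k) t0.
have sI's k := sqint_pieces_int (S' k) s0.
have sV k := sqint_cutoff_pieces_val (S k) s; have sV' k := sqint_cutoff_pieces_val (S' k) s.
have sV't k := sqint_cutoff_pieces_val (S' k) t.
(* the approximations for t also approximate f on [0, s] *)
have Sf's : L2cvg mu (fun k => cutoff s (pieces_val (S' k))) (cutoff s f).
  apply: (squeeze_cvgr _ (cvg_cst 0) Sf'); near=> k; rewrite ip_ge0/=.
  rewrite -(funext (cutoffB s _ _)) -(funext (cutoffB t _ _)).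
  apply: (sqint_cutoff_le st _).2.
  by rewrite (funext (cutoffB t _ _)); exact: sqintB.
pose D k := S' k ++ map (scale_piece (-1)) (S k).
have DE k om : pieces_int (D k) s om = pieces_int (S' k) s om - pieces_int (S k) s om.
  by rewrite pieces_intD pieces_intZ mulN1r.
have sD k := sqint_cutoff_pieces_val (D k) s.
have sID k := sqint_pieces_int (D k) s0.
pose zero (z : measurableTypeR R * Omega) := cutoff s f z + -1 * cutoff s f z.
have szero : sqint mu zero by apply: sqintD => //; exact: sqintZ.
have D0 : L2cvg mu (fun k => cutoff s (pieces_val (D k))) zero.
  have := L2cvgD sV' sfs (fun k => sqintZ (-1) (sV k)) (sqintZ (-1) sfs) Sf's
    (L2cvgZ (-1) sV sfs Sf).
  congr (L2cvg mu _ _); apply/funext => k; apply/funext => z.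
  rewrite -cutoffZ -cutoffD; congr (cutoff s _ z).
  by apply/funext => r; apply/funext => om; rewrite pieces_valD pieces_valZ.
have ID0 : L2cvg P (fun k => pieces_int (D k) s) (fun=> 0).
  have := cvg_ip sD szero sD szero D0 D0.
  rewrite (_ : ip mu zero zero = 0); last first.
    rewrite -[RHS](ip0l mu zero); apply: eq_ip => z //.
    by rewrite /zero mulN1r subrr.
  rewrite /L2cvg (_ : (fun k => ip P _ _) = (fun k => ip mu
    (cutoff s (pieces_val (D k))) (cutoff s (pieces_val (D k)))))//.
  apply/funext => k; rewrite -simple_isometry//.
  by apply: eq_ip => om; rewrite subr0.
have lim1 := cvg_ip (fun=> sY) sY sID (sqint0 P) (L2cvg_cst P Y) ID0.
have limt := cvg_ip (fun=> sY) sY sI' sZt (L2cvg_cst P Y) SZ'.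
have lims := cvg_ip (fun=> sY) sY sI sZs (L2cvg_cst P Y) SZ.
have DYE : (fun k => ip P Y (pieces_int (D k) s)) =
    (fun k => ip P Y (pieces_int (S' k) t) - ip P Y (pieces_int (S k) s)).
  apply/funext => k; rewrite (eq_ip P (fun om => erefl (Y om)) (DE k)) ipBr//.
  by rewrite (pieces_martingale _ s0 st).
rewrite DYE in lim1; apply: subr0_eq.
rewrite -[RHS](ip0l P Y) (ipC P (fun=> 0)).
exact: (cvg_unique _ (cvgB limt lims) lim1).
Unshelve. all: by end_near. Qed.

End ItoIntegral.

(** * Iterated inner products and the square of a primitive *)

Section IteratedInnerProducts.
Context d1 d2 (T1 : measurableType d1) (T2 : measurableType d2) (R : realType).
Variables (m1 : {sigma_finite_measure set T1 -> \bar R}).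
Variables (m2 : {sigma_finite_measure set T2 -> \bar R}).
Local Notation mu := (m1 \x m2)%E.
Implicit Types f g : T1 * T2 -> R.

Lemma ae_sqint_section1 f : sqint mu f -> {ae m1, forall x, sqint m2 (fun y => f (x, y))}.
Proof.
move=> sf; have iff := sqint_integrable_mul sf sf.
apply: filterS (ae_integrable1 iff) => x ix; split.
  by apply: measurableT_comp; [case: sf|exact: pair1_measurable].
exact: integrable_lty ix.
Qed.

Lemma ae_sqint_section2 f : sqint mu f -> {ae m2, forall y, sqint m1 (fun x => f (x, y))}.
Proof.
move=> sf; have iff := sqint_integrable_mul sf sf.
apply: filterS (ae_integrable2 iff) => y iy; split.
  by apply: measurableT_comp; [case: sf|exact: pair2_measurable].
exact: integrable_lty iy.
Qed.

(** Compares inner products of processes one time at a time. *)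
Lemma eq_ip_sections1 f g g' : sqint mu f -> sqint mu g -> sqint mu g' ->
  (forall x, sqint m2 (fun y => f (x, y)) ->
    ip m2 (fun y => f (x, y)) (fun y => g (x, y))
    = ip m2 (fun y => f (x, y)) (fun y => g' (x, y))) ->
  ip mu f g = ip mu f g'.
Proof.
move=> sf sg sg' fgg'; apply: EFin_inj; rewrite !EFin_ip//.
have ig := sqint_integrable_mul sf sg; have ig' := sqint_integrable_mul sf sg'.
rewrite -(integral12_prod_meas1 ig) -(integral12_prod_meas1 ig').
apply: ae_eq_integral => //.
- exact: measurable_fubini_F ig.
- exact: measurable_fubini_F ig'.
apply: filterS3 (ae_sqint_section1 sf) (ae_sqint_section1 sg) (ae_sqint_section1 sg').
move=> x sfx sgx sgx' _.
by rewrite /fubini_F -!EFin_ip// fgg'.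
Qed.

(** Computes inner products of processes path by path. *)
Lemma ip_sections2 f g (h : T2 -> R) : sqint mu f -> sqint mu g ->
  measurable_fun setT h ->
  (forall y, sqint m1 (fun x => f (x, y)) -> sqint m1 (fun x => g (x, y)) ->
    ip m1 (fun x => f (x, y)) (fun x => g (x, y)) = h y) ->
  ip mu f g = \int[m2]_y h y.
Proof.
move=> sf sg mh fgh; have ig := sqint_integrable_mul sf sg.
rewrite /ip /Rintegral -integral21_prod_meas1//; congr fine; apply: ae_eq_integral => //.
- exact: measurable_fubini_G ig.
- exact/measurable_EFinP.
apply: filterS2 (ae_sqint_section2 sf) (ae_sqint_section2 sg) => y sfy sgy _.
by rewrite /fubini_G -EFin_ip// fgh.
Qed.

End IteratedInnerProducts.

Section PrimitiveSquared.
Context (R : realType).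
Local Notation leb := (@lebesgue_measure R).
Local Notation mR := (measurableTypeR R).

(** The indicator of r <= t at z = (t, r), in a form whose measurability is
    immediate. *)
Definition below (z : mR * mR) : R := \1_`[0, +oo[ (z.1 - z.2).

Lemma belowE (t r : R) : below (t, r) = (r <= t)%R%:R.
Proof. by rewrite /below indicE mem_setE in_itv/= andbT subr_ge0. Qed.

Lemma measurable_below : measurable_fun setT below.
Proof.
apply: measurableT_comp; first by apply: measurable_indic; exact: measurable_itv.
by apply: measurable_funB; [exact: measurable_fst|exact: measurable_snd].
Qed.

Let below_le1 z : `|below z| <= 1.
Proof.
by case: z => t r; rewrite belowE; case: (r <= t); rewrite ?normr1 ?normr0.
Qed.

Let above (z : mR * mR) := below (z.2, z.1).

Let measurable_above : measurable_fun setT above.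
Proof. exact: (measurableT_comp measurable_below (@measurable_swap _ _ mR mR)). Qed.

Let split_diag (t r c : R) : r != t -> below (t, r) * c + above (t, r) * c = c.
Proof.
rewrite /above !belowE.
by case: ltgtP => // _ _; rewrite ?mul1r ?mul0r ?addr0 ?add0r.
Qed.

Variable f : mR -> R.
Hypothesis intf : leb.-integrable setT (EFin \o f).

Let mf : measurable_fun setT f.
Proof. by apply/measurable_EFinP; exact: measurable_int intf. Qed.

Let half (c : mR * mR -> R) (t : R) : measurable_fun setT c -> (forall z, `|c z| <= 1) ->
  leb.-integrable setT (EFin \o (fun r : mR => c (t, r) * f r)).
Proof.
move=> mc c1; have mct := measurableT_comp mc (pair1_measurable (t : mR)).
exact: (integrable_bounded_mul mct (fun r => c1 (t, r)) intf).
Qed.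

Let total t : \int[leb]_r (below (t, r) * f r) + \int[leb]_r (above (t, r) * f r)
  = \int[leb]_r f r.
Proof.
have i1 := half t measurable_below below_le1.
have i2 := half t measurable_above (fun z => below_le1 (z.2, z.1)).
have i12 := integrableD measurableT i1 i2.
rewrite -(RintegralD measurableT i1 i2); apply: ae_eq_Rintegral; [|exact: mf|].
  by apply/measurable_EFinP; exact: measurable_int i12.
exists [set (t : mR)]; split; [exact: measurable_set1|exact: lebesgue_measure_set1|].
move=> r /=; apply: contra_notP => /eqP rt; exact: split_diag.
Qed.

Let g (z : mR * mR) := f z.1 * f z.2.

Let integrable_g : (leb \x leb)%E.-integrable setT (EFin \o g).
Proof.
have mg : measurable_fun setT g by apply: measurable_funM; apply: measurableT_comp.
have /integrableP[_ f_lty] := intf.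
apply/integrable12ltyP; first exact/measurable_EFinP.
under eq_integral => x _.
  under eq_integral do rewrite /= /g/= normrM EFinM.
  rewrite ge0_integralZl//; last by apply/measurable_EFinP; exact: measurableT_comp.
  over.
rewrite ge0_integralZr//; last 2 first.
- by apply/measurable_EFinP; exact: measurableT_comp.
- exact: integral_ge0.
by rewrite lte_mul_pinfty// ?integral_ge0// ge0_fin_numE ?integral_ge0.
Qed.

Let section_integral (c : mR * mR -> R) (t : mR) :
  measurable_fun setT c -> (forall z, `|c z| <= 1) ->
  (\int[leb]_r (c (t, r) * g (t, r))%:E
  = (f t * \int[leb]_r (c (t, r) * f r))%:E)%E.
Proof.
move=> mc c1; have ic := half t mc c1.
rewrite -(RintegralZl _ measurableT ic) /Rintegral fineK.
  by apply: eq_integral => r _; rewrite mulrCA.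
apply: integrable_fin_num => //.
exact: eq_integrable (integrableZl measurableT (f t) ic).
Qed.

(** The integral analogue of (F^2)' = 2 F f, for f merely integrable: split the
    square of integration along its diagonal. *)
Lemma Rintegral_sqr_triangle :
  2 * \int[leb]_t (f t * \int[leb]_r (below (t, r) * f r))
  = (\int[leb]_t f t) ^+ 2.
Proof.
pose U z := below z * g z; pose V z := above z * g z.
have bU := below_le1; have bV z : `|above z| <= 1 by exact: below_le1.
have iU := integrable_bounded_mul measurable_below bU integrable_g.
have iV := integrable_bounded_mul measurable_above bV integrable_g.
pose hU t := f t * \int[leb]_r (below (t, r) * f r).
pose hV t := f t * \int[leb]_r (above (t, r) * f r).
have ihU : leb.-integrable setT (EFin \o hU).
  apply: eq_integrable (integrable_fubini_F iU); first exact: measurableT.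
  by move=> t _; exact: section_integral measurable_below bU.
have ihV : leb.-integrable setT (EFin \o hV).
  apply: eq_integrable (integrable_fubini_F iV); first exact: measurableT.
  by move=> t _; exact: section_integral measurable_above bV.
have symm : \int[leb]_t hU t = \int[leb]_t hV t.
  apply: (congr1 fine); transitivity (\int[leb]_t \int[leb]_r (U (t, r))%:E)%E.
    by apply: eq_integral => t _; rewrite -(section_integral t measurable_below bU).
  rewrite (Fubini iU); apply: eq_integral => t _.
  rewrite -(section_integral t measurable_above bV); apply: eq_integral => r _.
  by congr EFin; rewrite /U /V /above /g/= [f r * _]mulrC.
rewrite mulr_natl mulr2n {2}symm -(RintegralD measurableT ihU ihV).
transitivity (\int[leb]_t (f t * \int[leb]_r f r)).
  by apply: eq_Rintegral => t _; rewrite -mulrDr total.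
by rewrite RintegralZr// expr2.
Qed.

End PrimitiveSquared.

(** * Ito's formula for the square, in expectation *)

Section ItoFormula.
Context (R : realType) (d : measure_display) (Omega : measurableType d).
Variables (P : probability Omega R) (F : R -> set (set Omega)).
Variable w : R -> Omega -> R.
Hypotheses (hF : is_filtration F) (hw : is_wiener P F w).
Local Notation leb := (@lebesgue_measure R).
Local Notation mR := (measurableTypeR R).
Local Notation mu := (leb \x P)%E.
Variable T : R.
Hypothesis T_gt0 : 0 < T.

Let cutoff_indic (v : R -> Omega -> R) (z : mR * Omega) :
  cutoff T v z = \1_(`[0, T]%classic : set mR) z.1 * v z.1 z.2.
Proof.
by rewrite /cutoff indicE mem_setE in_itv/=; case: ifP; rewrite ?mul1r ?mul0r.
Qed.

Let indicT (r : mR) : R := \1_(`[0, T]%classic : set mR) r.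

Let measurable_indicT : measurable_fun setT indicT.
Proof. by apply: measurable_indic; exact: measurable_itv. Qed.

Let indicT_int : (\int[leb]_r (indicT r)%:E = T%:E)%E.
Proof.
rewrite integral_indic//= setIT.
rewrite [LHS](_ : _ = leb (`[0, T]%classic : set mR))//.
by rewrite lebesgue_measure_itv/= lte_fin T_gt0 oppr0 adde0.
Qed.

Let sqint_indicT : sqint leb indicT.
Proof.
split => //; rewrite (eq_integral (fun r => (indicT r)%:E)) ?indicT_int ?ltry//.
by move=> r _; rewrite /indicT indicE; case: (_ \in _); rewrite ?expr1n ?expr0n.
Qed.

Let ip_indicT : ip leb indicT indicT = T.
Proof.
apply: EFin_inj; rewrite EFin_ip// -indicT_int; apply: eq_integral => r _.
by rewrite /indicT indicE; case: (_ \in _); rewrite ?mulr1 ?mulr0.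
Qed.

Section Primitive.
Variable a : R -> Omega -> R.
Local Notation al := (cutoff T a).

Definition primitive (t : R) (om : Omega) : R :=
  \int[leb]_r (below (t, r) * al (r, om)).

Lemma primitiveE t om : t <= T ->
  primitive t om = \int[leb]_(s in `[0, t]) a s om.
Proof.
move=> tT; rewrite [RHS]Rintegral_mkcond; apply: eq_Rintegral => r _.
rewrite belowE /cutoff patchE mem_setE in_itv/=.
have [rt|tr] := leP r t; last by rewrite andbF mul0r.
by rewrite andbT (le_trans rt tT) andbT mul1r.
Qed.

Hypothesis s_al : sqint mu al.

Let measurable_al_section om : measurable_fun setT (fun r : mR => al (r, om)).
Proof. by apply: measurableT_comp; [case: s_al|exact: pair2_measurable]. Qed.

Let al_indic r om : al (r, om) = indicT r * al (r, om).
Proof.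
by rewrite /indicT indicE mem_setE in_itv /cutoff/=; case: ifP; rewrite ?mul1r ?mulr0.
Qed.

Lemma measurable_primitive :
  measurable_fun setT (fun z : mR * Omega => primitive z.1 z.2).
Proof.
pose h (z : mR * (mR * Omega)) : R := below (z.2.1, z.1) * al (z.1, z.2.2).
have mh : measurable_fun setT h.
  apply: measurable_funM.
    apply: (measurableT_comp (@measurable_below R)).
    apply/measurable_fun_pairP; split; last exact: measurable_fst.
    exact: (measurableT_comp measurable_fst measurable_snd).
  apply: measurableT_comp; first by case: s_al.
  apply/measurable_fun_pairP; split; first exact: measurable_fst.
  exact: (measurableT_comp measurable_snd measurable_snd).
have mEh : measurable_fun setT (EFin \o h) by exact/measurable_EFinP.
have mp := measurable_fun_fubini_tonelli_G (m1 := leb) ((EFin \o h)^\+)%E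
  (measurable_funepos mEh) (funepos_ge0 _).
have mn := measurable_fun_fubini_tonelli_G (m1 := leb) ((EFin \o h)^\-)%E
  (measurable_funeneg mEh) (funeneg_ge0 _).
rewrite (_ : (fun z => _) = fine \o (fubini_G leb (EFin \o h)^\+ \- fubini_G leb (EFin \o h)^\-)%E).
  by apply: measurableT_comp => //; exact: emeasurable_funB.
apply/funext => z; rewrite /primitive /Rintegral /= integralE.
by congr (fine (_ - _)); apply: eq_integral => r _; rewrite ?funeposE ?funenegE.
Qed.

Let al_sq om := (\int[leb]_r (al (r, om) ^+ 2)%:E)%E.

(** Cauchy--Schwarz in time; if the path is not square-integrable, the
    right-hand side is infinite. *)
Lemma primitive_sqr_le t om : ((primitive t om ^+ 2)%:E <= T%:E * al_sq om)%E.
Proof.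
have al0 : (0 <= al_sq om)%E by apply: integral_ge0 => r _; rewrite lee_fin sqr_ge0.
have [fin|inf] := ltP (al_sq om) (+oo)%E; last first.
  have -> : al_sq om = (+oo)%E by apply/eqP; rewrite -leye_eq.
  by rewrite gt0_muley ?lte_fin// leey.
have sal : sqint leb (fun r => al (r, om)) by split.
pose c (r : mR) := below (t, r) * indicT r.
have mbt : measurable_fun setT (fun r : mR => below ((t : mR), r)).
  exact: measurableT_comp (@measurable_below R) (pair1_measurable (t : mR)).
have b1 (r : mR) : `|below ((t : mR), r)| <= 1.
  by rewrite belowE; case: (r <= t); rewrite ?normr1 ?normr0.
have sc : sqint leb c by exact: (sqint_bounded_mul mbt b1).
have -> : primitive t om = ip leb c (fun r => al (r, om)).
  by apply: eq_Rintegral => r _; rewrite /c -mulrA -al_indic.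
have -> : al_sq om = (ip leb (fun r => al (r, om)) (fun r => al (r, om)))%:E.
  by rewrite EFin_ip_sqr.
rewrite -EFinM lee_fin.
rewrite -(real_normK (num_real (ip leb c _))).
apply: (@le_trans _ _ ((Num.sqrt (ip leb c c) *
    Num.sqrt (ip leb (fun r => al (r, om)) (fun r => al (r, om)))) ^+ 2)).
  rewrite ler_pXn2r ?nnegrE ?mulr_ge0 ?sqrtr_ge0//.
  exact: CauchySchwarz_ip.
rewrite exprMn !sqr_sqrtr ?ip_ge0// ler_wpM2r ?ip_ge0//.
by have := ip_bounded_mul_le mbt b1 sqint_indicT; rewrite expr1n mul1r ip_indicT.
Qed.

Let m_al2 : measurable_fun setT (fun z : mR * Omega => (al z ^+ 2)%:E).
Proof. by apply/measurable_EFinP; apply: measurable_funX; case: s_al. Qed.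

Let measurable_al_sq : measurable_fun setT al_sq.
Proof.
apply: (measurable_fun_fubini_tonelli_G (m1 := leb) _ m_al2) => z.
by rewrite lee_fin sqr_ge0.
Qed.

Let al_sq_ge0 om : (0 <= al_sq om)%E.
Proof. by apply: integral_ge0 => r _; rewrite lee_fin sqr_ge0. Qed.

Let al_sq_lty : (\int[P]_om al_sq om < +oo)%E.
Proof.
have := s_al.2; rewrite (fubini_tonelli2 _ m_al2)//.
by move=> z; rewrite lee_fin sqr_ge0.
Qed.

Lemma sqint_primitive t : sqint P (primitive t).
Proof.
have mt : measurable_fun setT (primitive t).
  exact: measurableT_comp measurable_primitive (pair1_measurable (t : mR)).
split => //; apply: (@le_lt_trans _ _ (\int[P]_om (T%:E * al_sq om))%E).
  apply: ge0_le_integral => //.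
  - by move=> om _; rewrite lee_fin sqr_ge0.
  - by apply/measurable_EFinP; exact: measurable_funX.
  - by apply: emeasurable_funM => //; exact: measurable_cst.
  - by move=> om _; exact: primitive_sqr_le.
rewrite ge0_integralZl//; last by rewrite lee_fin ltW.
by rewrite lte_mul_pinfty// lee_fin ltW.
Qed.

Lemma sqint_cutoff_primitive : sqint mu (cutoff T primitive).
Proof.
have mcp : measurable_fun setT (cutoff T primitive).
  rewrite (funext (cutoff_indic primitive)); apply: measurable_funM.
    by apply: measurableT_comp; [exact: measurable_indicT|exact: measurable_fst].
  exact: measurable_primitive.
have mcp2 : measurable_fun setT (fun z => (cutoff T primitive z ^+ 2)%:E).
  by apply/measurable_EFinP; exact: measurable_funX.
split => //; rewrite (fubini_tonelli2 _ mcp2); last first.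
  by move=> z; rewrite lee_fin sqr_ge0.
apply: (@le_lt_trans _ _ (\int[P]_om ((T * T)%:E * al_sq om))%E).
  apply: ge0_le_integral => //.
  - by move=> om _; apply: integral_ge0 => r _; rewrite lee_fin sqr_ge0.
  - apply: (measurable_fun_fubini_tonelli_G (m1 := leb) _ mcp2) => z.
    by rewrite lee_fin sqr_ge0.
  - by apply: emeasurable_funM => //; exact: measurable_cst.
  move=> om _; rewrite /fubini_G.
  apply: (@le_trans _ _ (\int[leb]_r ((indicT r)%:E * (T%:E * al_sq om)))%E).
    apply: ge0_le_integral => //.
    - by move=> r _; rewrite lee_fin sqr_ge0.
    - exact: measurableT_comp mcp2 (pair2_measurable om).
    - by apply: emeasurable_funM; [exact/measurable_EFinP|exact: measurable_cst].
    move=> r _; rewrite cutoff_indic exprMn EFinM /=.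
    have -> : (\1_(`[0, T]%classic : set mR) r : R) ^+ 2 = indicT r.
      by rewrite /indicT indicE; case: (_ \in _); rewrite ?expr1n ?expr0n.
    by apply: lee_wpmul2l; [rewrite lee_fin|exact: primitive_sqr_le].
  rewrite ge0_integralZr//.
  - by rewrite indicT_int muleA -EFinM.
  - exact/measurable_EFinP.
  - by move=> r _; rewrite lee_fin.
  - by rewrite mule_ge0// lee_fin ltW.
rewrite ge0_integralZl//; last by rewrite lee_fin mulr_ge0// ltW.
by rewrite lte_mul_pinfty// lee_fin mulr_ge0// ltW.
Qed.

Lemma primitive_end om : primitive T om = \int[leb]_r al (r, om).
Proof.
apply: eq_Rintegral => r _; rewrite belowE al_indic /indicT indicE mem_setE in_itv/=.
by case: (r <= T); rewrite ?andbF ?mul0r ?mulr0// mul1r.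
Qed.

Lemma integrable_al_section om : sqint leb (fun r => al (r, om)) ->
  leb.-integrable setT (EFin \o (fun r : mR => al (r, om))).
Proof.
move=> /(sqint_integrable_mul sqint_indicT).
by apply: eq_integrable => // r _; rewrite -al_indic.
Qed.

Lemma ip_primitive : 2 * ip mu al (cutoff T primitive) = ip P (primitive T) (primitive T).
Proof.
have sDT := sqint_primitive T.
rewrite (ip_sections2 (h := fun om => 2^-1 * (primitive T om * primitive T om)) s_al
  sqint_cutoff_primitive).
- rewrite RintegralZl//; last exact: sqint_integrable_mul.
  by rewrite mulrA mulfV// mul1r.
- by apply: measurable_funM => //; apply: measurable_funM; case: sDT.
move=> om /integrable_al_section ial _.
rewrite primitive_end.
rewrite -expr2 -(Rintegral_sqr_triangle ial) mulrA mulVf// mul1r.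
apply: eq_Rintegral => r _; rewrite /cutoff/=.
by case: ifP => // _; rewrite !mul0r.
Qed.

End Primitive.

(** Ito formula for the square, in expectation.  Writing X = D + Z with D the
    primitive of the drift and Z the stochastic integral: the martingale
    property replaces Z_T by Z_t in E[a_t Z_T], which together with
    E[D_T^2] = 2 E int a D recombines into the drift term 2 E int a X. *)
Lemma ito_formula_sqr (a b X : R -> Omega -> R) :
  sqint mu (cutoff T a) -> sqint mu (cutoff T X) ->
  (forall t, 0 <= t <= T -> measurable_wrt (F t) (a t)) ->
  (forall t, 0 <= t <= T -> measurable_fun setT (X t)) ->
  (forall t, 0 <= t <= T -> exists2 Z, ito_integral P F w b t Z &
    {ae P, forall om, X t om = \int[leb]_(s in `[0, t]) a s om + Z om}) ->
  ip P (X T) (X T) = 2 * ip mu (cutoff T a) (cutoff T X)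
                     + ip mu (cutoff T b) (cutoff T b).
Proof.
move=> sa sX aF mX XZ; have T0 := ltW T_gt0.
have TT : 0 <= T <= T by rewrite lexx T0.
have [Z IZ XE] := XZ T TT; have [_ sZ _] := IZ.
have sD t := sqint_primitive sa t; have sDT := sD T.
have sDZ := sqintD sDT sZ.
have mXT := mX T TT.
have XE' t Y : t <= T ->
    {ae P, forall om, X t om = \int[leb]_(s in `[0, t]) a s om + Y om} ->
    {ae P, forall om, X t om = primitive a t om + Y om}.
  by move=> tT; apply: filterS => om ->; rewrite primitiveE.
have -> : ip P (X T) (X T) = ip P (primitive a T) (primitive a T)
    + 2 * ip P (primitive a T) Z + ip P Z Z.
  have mDZ : measurable_fun setT (fun om => primitive a T om + Z om) by case: sDZ.
  have eqX := XE' T Z (lexx _) XE.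
  rewrite (ae_eq_ip mXT mDZ mXT eqX) ipC (ae_eq_ip mXT mDZ mDZ eqX).
  by rewrite ipDl// !ipDr// (ipC P Z (primitive a T)); ring.
rewrite (ito_isometry hF hw T0 IZ); congr (_ + _).
have scZ : sqint mu (cutoff T (fun=> Z)).
  have mcZ : measurable_fun setT (cutoff T (fun=> Z)).
    rewrite (funext (cutoff_indic _)); apply: measurable_funM.
      by apply: measurableT_comp; [exact: measurable_indicT|exact: measurable_fst].
    by apply: measurableT_comp; [case: sZ|exact: measurable_snd].
  have mcZ2 : measurable_fun setT (fun z => (cutoff T (fun=> Z) z ^+ 2)%:E).
    by apply/measurable_EFinP; exact: measurable_funX.
  split => //; rewrite (fubini_tonelli2 _ mcZ2); last first.
    by move=> z; rewrite lee_fin sqr_ge0.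
  rewrite (eq_integral (fun om => (T%:E * (Z om ^+ 2)%:E)%E)); last first.
    move=> om _; rewrite /fubini_G -indicT_int -ge0_integralZr//.
    - apply: eq_integral => r _; rewrite cutoff_indic -EFinM /=; congr EFin.
      by rewrite /indicT indicE; case: (_ \in _); rewrite ?mul1r ?mul0r ?expr0n.
    - exact/measurable_EFinP.
    - by move=> r _; rewrite lee_fin.
    - by rewrite lee_fin sqr_ge0.
  rewrite ge0_integralZl//.
  - by rewrite lte_mul_pinfty ?lee_fin//; case: sZ.
  - by apply/measurable_EFinP; apply: measurable_funX; case: sZ.
  - by move=> om _; rewrite lee_fin sqr_ge0.
have -> : ip P (primitive a T) Z = ip mu (cutoff T a) (cutoff T (fun=> Z)).
  apply/esym; apply: (ip_sections2 sa scZ).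
    by apply: measurable_funM; [case: sDT|case: sZ].
  move=> om /integrable_al_section ial _.
  rewrite primitive_end -(RintegralZr (Z om) measurableT ial); apply: eq_Rintegral => r _.
  by rewrite /cutoff/=; case: ifP => // _; rewrite !mul0r.
have sP := sqint_cutoff_primitive sa.
have -> : ip mu (cutoff T a) (cutoff T (fun=> Z))
    = ip mu (cutoff T a) (fun z => cutoff T X z - cutoff T (primitive a) z).
  apply: (eq_ip_sections1 sa scZ (sqintB sX sP)) => t /=.
  rewrite /cutoff/=; case: (boolP (0 <= t <= T)) => tT sat; last by rewrite !ip0l.
  have /andP[t0 tT'] := tT.
  have [Zt IZt XEt] := XZ t tT; have [_ sZt _] := IZt.
  rewrite (ito_martingale hF hw t0 tT' IZt IZ (aF t tT) sat) ipC [RHS]ipC.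
  apply: ae_eq_ip.
  - by case: sZt.
  - by apply: measurable_funB; [exact: mX|case: (sD t)].
  - by case: sat.
  by apply: filterS (XE' t Zt tT' XEt) => om XDZ; rewrite XDZ addrC addKr.
by rewrite ipBr// mulrBr ip_primitive//; ring.
Qed.

End ItoFormula.

(** * Coordinates of vector-valued processes *)

Section VectorProcesses.
Context (R : realType) (d : measure_display) (Omega : measurableType d).
Variable P : probability Omega R.
Local Notation leb := (@lebesgue_measure R).
Local Notation mR := (measurableTypeR R).
Local Notation mu := (leb \x P)%E.

Definition entry n (v : process R Omega n) (i : 'I_n) (t : R) (om : Omega) : R :=
  v t om i 0.

Lemma measurable_cutoff (T : R) (v : R -> Omega -> R) :
  measurable_fun (`[0, T] `*` setT) (fun p : R * Omega => v p.1 p.2) ->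
  measurable_fun setT (cutoff T v).
Proof.
move=> mv; have mD : measurable (`[0, T]%classic `*` setT : set (R * Omega)).
  by apply: measurableX => //; exact: measurable_itv.
rewrite (_ : cutoff T v = (fun p : R * Omega => v p.1 p.2) \_ (`[0, T] `*` setT)).
  exact: (measurable_restrictT _ mD).1.
apply/funext => -[t om]; rewrite /cutoff patchE.
case: (boolP (0 <= t <= T)) => tT.
  by rewrite ifT// inE /= in_itv.
rewrite ifF//; apply: negbTE; apply: contra tT; rewrite inE /= in_itv/=.
by move=> [].
Qed.

Lemma L2w_norm_cutoff n (T : R) (v : process R Omega n) :
  (forall i, measurable_fun setT (cutoff T (entry v i))) ->
  L2w_norm P T v = sqrte (\sum_(i < n) \int[mu]_z (cutoff T (entry v i) z ^+ 2)%:E)%E.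
Proof.
move=> mv; have mv2 i : measurable_fun setT (fun z => (cutoff T (entry v i) z ^+ 2)%:E).
  by apply/measurable_EFinP; exact: measurable_funX.
have v0 i z : (0 <= (cutoff T (entry v i) z ^+ 2)%:E)%E by rewrite lee_fin sqr_ge0.
congr sqrte.
transitivity (\int[P]_om \sum_(i < n) \int[leb]_t (cutoff T (entry v i) (t, om) ^+ 2)%:E)%E.
  apply: eq_integral => om _; rewrite -ge0_integral_sum//.
    rewrite [LHS]integral_mkcond; apply: eq_integral => t _.
    rewrite patchE mem_setE in_itv/= sumEFin /cutoff/=; case: ifP => // _.
    by rewrite big1// => i _; rewrite expr0n.
  by move=> i; exact: measurableT_comp (mv2 i) (pair2_measurable om).
rewrite ge0_integral_sum//.
- by apply: eq_bigr => i _; rewrite (fubini_tonelli2 _ (mv2 i)).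
- by move=> i; exact: (measurable_fun_fubini_tonelli_G (m1 := leb) _ (mv2 i)).
- by move=> i om _; apply: integral_ge0.
Qed.

Lemma L2w_norm_sqint n (T : R) (v : process R Omega n) :
  (forall i, sqint mu (cutoff T (entry v i))) ->
  L2w_norm P T v = (Num.sqrt (\sum_(i < n)
    ip mu (cutoff T (entry v i)) (cutoff T (entry v i))))%:E.
Proof.
move=> sv; rewrite L2w_norm_cutoff; last by move=> i; case: (sv i).
rewrite (eq_bigr (fun i => (ip mu (cutoff T (entry v i)) (cutoff T (entry v i)))%:E)).
  by rewrite sumEFin.
by move=> i _; rewrite EFin_ip_sqr.
Qed.

Lemma in_L2w_sqint n F (T : R) (v : process R Omega n) :
  in_L2w P F T v -> forall i, sqint mu (cutoff T (entry v i)).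
Proof.
move=> [mv _ v_lty] i; have mcv j : measurable_fun setT (cutoff T (entry v j)).
  exact: measurable_cutoff (mv j).
split => //; move: v_lty; rewrite L2w_norm_cutoff//.
have h0 j : (0 <= \int[mu]_z (cutoff T (entry v j) z ^+ 2)%:E)%E.
  by apply: integral_ge0 => z _; rewrite lee_fin sqr_ge0.
rewrite (bigD1 i)//=; set r := (\int[mu]_z _)%E; set s := (\sum_(_ | _) _)%E.
have s0 : (0 <= s)%E by exact: sume_ge0.
have : (0 <= r)%E by exact: h0.
by case: r => [r| |]//= _; [rewrite ltry|case: s s0].
Qed.

End VectorProcesses.

Section ItoIntegralCoordinates.
Context (R : realType) (d : measure_display) (Omega : measurableType d).
Variables (P : probability Omega R) (F : R -> set (set Omega)).
Variable w : R -> Omega -> R.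
Hypotheses (hF : is_filtration F) (hw : is_wiener P F w).
Local Notation leb := (@lebesgue_measure R).
Local Notation mR := (measurableTypeR R).
Local Notation mu := (leb \x P)%E.

Let sp_time_nneg n (S : simple_process F n) j : (j <= sp_size S)%N -> 0 <= sp_time S j.
Proof.
elim: j => [_|j IHj jS]; first exact: sp_time_ge0.
by apply: le_trans (IHj (ltnW jS)) _; exact: sp_time_le.
Qed.

Let sp_coef_adapted n (S : simple_process F n) (i : 'I_n) (j : 'I_(sp_size S)) :
  bounded_adapted F (sp_time S j) (fun om => sp_coef S j om i 0).
Proof.
split; first exact: sp_coef_measurable.
by have [M SM] := sp_coef_bounded (ltn_ord j); exists M.
Qed.

Definition entry_pieces n (S : simple_process F n) (i : 'I_n) : seq (piece F) :=
  [seq Piece (sp_time_nneg (ltnW (ltn_ord j))) (sp_time_le (ltn_ord j))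
    (sp_coef_adapted i j) | j <- enum 'I_(sp_size S)].

Lemma entry_pieces_val n (S : simple_process F n) i t om :
  pieces_val (entry_pieces S i) t om = simple_val S t om i 0.
Proof.
rewrite /pieces_val big_map big_enum /simple_val summxE [RHS]big_mkcond/=.
by apply: eq_bigr => j _; rewrite /piece_val/=.
Qed.

Lemma entry_pieces_int n (S : simple_process F n) i t om :
  pieces_int w (entry_pieces S i) t om = simple_integral S w t om i 0.
Proof.
rewrite /pieces_int big_map big_enum /simple_integral summxE.
by apply: eq_bigr => j _; rewrite mxE mulrC.
Qed.

Let cvg_sqrt0 (u : nat -> R) : (forall k, 0 <= u k) ->
  (Num.sqrt (u k))%:E @[k --> \oo] --> 0%E -> u k @[k --> \oo] --> 0.
Proof.
move=> u0 /fine_cvgP[_ su].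
have -> : u = (fun k => Num.sqrt (u k) * Num.sqrt (u k)).
  by apply/funext => k; rewrite -expr2 sqr_sqrtr.
by rewrite -[X in _ --> X](mul0r 0); apply: cvgM.
Qed.

Let cvg_sum_nonneg n (u : 'I_n -> nat -> R) : (forall i k, 0 <= u i k) ->
  (\sum_(i < n) u i k) @[k --> \oo] --> 0 -> forall i, u i k @[k --> \oo] --> 0.
Proof.
move=> u0 su i; apply: (squeeze_cvgr _ (cvg_cst 0) su); near=> k.
by rewrite u0/= (bigD1 i)//= lerDl sumr_ge0.
Unshelve. all: by end_near. Qed.

(** Every coordinate of a vector-valued Ito integral is a scalar one: the
    coordinates of a simple process form a family of pieces, and convergence of
    the Euclidean norms implies that of the coordinates. *)
Lemma ito_integral_entry n (f : process R Omega n) t Z : 0 <= t ->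
  is_ito_integral P F w f t Z ->
  forall i, ito_integral P F w (entry f i) t (fun om => Z om i 0).
Proof.
move=> t0 [fL2 mZ [S [Sf SZ]]].
have sf := in_L2w_sqint fL2.
have sS k i := sqint_cutoff_pieces_val P hF (entry_pieces (S k) i) t.
have sI k i := sqint_pieces_int hF hw (entry_pieces (S k) i) t0.
pose e k i (z : mR * Omega) := cutoff t (pieces_val (entry_pieces (S k) i)) z
  - cutoff t (entry f i) z.
have se k i : sqint mu (e k i) by exact: sqintB.
have normE k : L2w_norm P t (fun s om => f s om - simple_val (S k) s om)
    = (Num.sqrt (\sum_(i < n) ip mu (e k i) (e k i)))%:E.
  have cE i : cutoff t (entry (fun s om => f s om - simple_val (S k) s om) i)
      = (fun z => - e k i z).
    apply/funext => z; rewrite /e -cutoffB /cutoff /entry.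
    by case: ifP => _; rewrite ?oppr0// entry_pieces_val !mxE opprB.
  rewrite L2w_norm_sqint => [|i]; last by rewrite cE; exact: sqintN.
  congr (Num.sqrt _)%:E; apply: eq_bigr => i _; rewrite cE.
  by apply: eq_Rintegral => z _; rewrite mulrNN.
rewrite (funext normE) in Sf.
have {}Sf := cvg_sum_nonneg (fun i k => ip_ge0 mu (e k i))
  (cvg_sqrt0 (fun k => sumr_ge0 _ (fun i _ => ip_ge0 mu (e k i))) Sf).
pose g k i om := pieces_int w (entry_pieces (S k) i) t om - Z om i 0.
have mg k i : measurable_fun setT (g k i).
  by apply: measurable_funB => //; case: (sI k i).
have EgE k : (\int[P]_om (sqnorm2 (Z om - simple_integral (S k) w t om))%:E
    = \sum_(i < n) \int[P]_om (g k i om ^+ 2)%:E)%E.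
  rewrite -ge0_integral_sum//.
  - apply: eq_integral => om _; rewrite sumEFin; congr EFin.
    apply: eq_bigr => i _; rewrite /g entry_pieces_int !mxE; ring.
  - by move=> i; apply/measurable_EFinP; exact: measurable_funX.
  - by move=> i om _; rewrite lee_fin sqr_ge0.
have g0 k i : (0 <= \int[P]_om (g k i om ^+ 2)%:E)%E.
  by apply: integral_ge0 => om _; rewrite lee_fin sqr_ge0.
have Eg_le k i : (\int[P]_om (g k i om ^+ 2)%:E <=
    \int[P]_om (sqnorm2 (Z om - simple_integral (S k) w t om))%:E)%E.
  by rewrite EgE (bigD1 i)//= leeDl// sume_ge0.
have sZ i : sqint P (fun om => Z om i 0).
  have /fine_cvgP[finZ _] := SZ.
  have [k _ /(_ k (leqnn k)) fink] := finZ.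
  have sg : sqint P (g k i).
    by split => //; apply: le_lt_trans (Eg_le k i) _; rewrite ltey_eq fink.
  apply: eq_sqint (sqintB (sI k i) sg) => om; rewrite /g; ring.
have sg k i : sqint P (g k i) by exact: sqintB.
have SgE k : (\int[P]_om (sqnorm2 (Z om - simple_integral (S k) w t om))%:E
    = (\sum_(i < n) ip P (g k i) (g k i))%:E)%E.
  by rewrite EgE -sumEFin; apply: eq_bigr => i _; rewrite EFin_ip_sqr.
rewrite (funext SgE) in SZ; move: SZ => /fine_cvgP[_ SZ].
have {}SZ := cvg_sum_nonneg (fun i k => ip_ge0 P (g k i)) SZ.
move=> i; split; [exact: sf|exact: sZ|].
by exists (fun k => entry_pieces (S k) i); split; [exact: Sf|exact: SZ].
Qed.

End ItoIntegralCoordinates.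

(** * Quadratic functionals of Ito processes *)

Section QuadraticFormIntegrals.
Context d (T : measurableType d) (R : realType) (m : {measure set T -> \bar R}).

Lemma Rintegral_sum I (s : seq I) (h : I -> T -> R) :
  (forall i, m.-integrable setT (EFin \o h i)) ->
  m.-integrable setT (EFin \o (fun x => \sum_(i <- s) h i x)) /\
  \int[m]_x (\sum_(i <- s) h i x) = \sum_(i <- s) \int[m]_x h i x.
Proof.
move=> ih; elim: s => [|i s [IH1 IH2]].
  rewrite big_nil; split.
    by apply: eq_integrable (integrable0 m _) => // x _; rewrite /= big_nil.
  rewrite /Rintegral (eq_integral (fun=> 0%E)) ?integral0// => x _.
  by rewrite big_nil.
rewrite big_cons -IH2 -(RintegralD measurableT (ih i) IH1); split.
  by apply: eq_integrable (integrableD measurableT (ih i) IH1) => // x _; rewrite /= big_cons.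
by apply: eq_Rintegral => x _; rewrite big_cons.
Qed.

Lemma Rintegral_bil n (W : 'M[R]_n) (f g : 'I_n -> T -> R) :
  (forall i, sqint m (f i)) -> (forall i, sqint m (g i)) ->
  m.-integrable setT (EFin \o (fun x => bil W (\col_i f i x) (\col_i g i x))) /\
  \int[m]_x bil W (\col_i f i x) (\col_i g i x) = \sum_i \sum_j W i j * ip m (f i) (g j).
Proof.
move=> sf sg.
have bE x : bil W (\col_i f i x) (\col_i g i x) = \sum_i \sum_j W i j * (f i x * g j x).
  by rewrite bil_sum; apply: eq_bigr => i _; apply: eq_bigr => j _; rewrite !mxE.
have i1 i j : m.-integrable setT (EFin \o (fun x => W i j * (f i x * g j x))).
  by apply: eq_integrable (integrableZl measurableT (W i j) (sqint_integrable_mul (sf i) (sg j))).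
have i2 i := Rintegral_sum (index_enum 'I_n) (i1 i).
have [i3 E3] := Rintegral_sum (index_enum 'I_n) (fun i => (i2 i).1).
split; first by apply: eq_integrable i3 => // x _; rewrite /= bE.
transitivity (\int[m]_x (\sum_i \sum_j W i j * (f i x * g j x))).
  by apply: eq_Rintegral => x _; rewrite bE.
rewrite E3; apply: eq_bigr => i _; rewrite (i2 i).2; apply: eq_bigr => j _.
by rewrite RintegralZl//; exact: sqint_integrable_mul.
Qed.

Lemma sum_ip_sqnorm n (f : 'I_n -> T -> R) : (forall i, sqint m (f i)) ->
  m.-integrable setT (EFin \o (fun x => sqnorm2 (\col_i f i x))) /\
  \int[m]_x sqnorm2 (\col_i f i x) = \sum_i ip m (f i) (f i).
Proof.
move=> sf; have [i1 E1] := Rintegral_bil 1%:M sf sf; split.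
  by apply: eq_integrable i1 => // x _; rewrite /= sqnorm2E.
transitivity (\int[m]_x bil 1%:M (\col_i f i x) (\col_i f i x)).
  by apply: eq_Rintegral => x _; rewrite sqnorm2E.
rewrite E1; apply: eq_bigr => i _; rewrite (bigD1 i)//= mxE eqxx mul1r big1 ?addr0//.
by move=> j ji; rewrite mxE eq_sym (negbTE ji) mul0r.
Qed.

End QuadraticFormIntegrals.

Section ItoProcesses.
Context (R : realType) (d : measure_display) (Omega : measurableType d).
Variables (P : probability Omega R) (F : R -> set (set Omega)).
Variable w : R -> Omega -> R.
Hypotheses (hF : is_filtration F) (hw : is_wiener P F w).
Local Notation leb := (@lebesgue_measure R).
Local Notation mR := (measurableTypeR R).
Local Notation mu := (leb \x P)%E.
Variable T : R.
Hypothesis T_gt0 : 0 < T.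

Let sF t : 0 <= t -> sigma_algebra setT (F t). Proof. by case: hF => + _ _; exact. Qed.
Let FM t : 0 <= t -> F t `<=` measurable. Proof. by case: hF => _ + _; exact. Qed.

(** dX = a dt + b dw with X(0) = 0, on [0, T]. *)
Definition ito_process (a b X : R -> Omega -> R) :=
  [/\ sqint mu (cutoff T a) /\ sqint mu (cutoff T b), sqint mu (cutoff T X),
    forall t, 0 <= t <= T -> measurable_wrt (F t) (a t),
    forall t, 0 <= t <= T -> measurable_fun setT (X t) &
    forall t, 0 <= t <= T -> exists2 Z, ito_integral P F w b t Z &
      {ae P, forall om, X t om = \int[leb]_(s in `[0, t]) a s om + Z om}].

Lemma ito_processD a b X a' b' X' : ito_process a b X -> ito_process a' b' X' ->
  ito_process (fun t om => a t om + a' t om) (fun t om => b t om + b' t om)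
    (fun t om => X t om + X' t om).
Proof.
move=> [[sa sb] sX aF mX XZ] [[sa' sb'] sX' aF' mX' XZ'].
have saD : sqint mu (cutoff T (fun t om => a t om + a' t om)).
  by rewrite (funext (cutoffD T a a')); exact: sqintD.
split.
- by split => //; rewrite (funext (cutoffD T b b')); exact: sqintD.
- by rewrite (funext (cutoffD T X X')); exact: sqintD.
- move=> t tT; have /andP[t0 _] := tT.
  by apply: measurable_wrtD; [exact: sF|exact: aF|exact: aF'].
- by move=> t tT; apply: measurable_funD; [exact: mX|exact: mX'].
move=> t tT; have /andP[t0 tleT] := tT.
have [Z IZ XE] := XZ t tT; have [Z' IZ' XE'] := XZ' t tT.
exists (fun om => Z om + Z' om); first exact: ito_integralD.
have XX'E : {ae P, forall om, X t om + X' t om = (\int[leb]_(s in `[0, t]) a s om + Z om)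
    + (\int[leb]_(s in `[0, t]) a' s om + Z' om)}.
  by apply: filterS2 XE XE' => om -> ->.
apply: filterS3 XX'E (ae_sqint_section2 sa) (ae_sqint_section2 sa') => om XX'om sao sao'.
have mb : measurable_fun setT (fun r : mR => below ((t : mR), r)).
  exact: measurableT_comp (@measurable_below R) (pair1_measurable (t : mR)).
have b1 (r : mR) : `|below ((t : mR), r)| <= 1.
  by rewrite belowE; case: (r <= t); rewrite ?normr1 ?normr0.
have i1 := integrable_bounded_mul mb b1 (integrable_al_section T_gt0 sao).
have i2 := integrable_bounded_mul mb b1 (integrable_al_section T_gt0 sao').
have -> : \int[leb]_(s in `[0, t]) (a s om + a' s om)
    = primitive T a t om + primitive T a' t om.
  rewrite -(primitiveE (fun s om => a s om + a' s om) om tleT).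
  rewrite /primitive -(RintegralD measurableT i1 i2).
  by apply: eq_Rintegral => r _; rewrite cutoffD mulrDr.
by rewrite XX'om (primitiveE a om tleT) (primitiveE a' om tleT) addrACA.
Qed.

Lemma ito_process_sqint a b X : ito_process a b X -> sqint P (X T).
Proof.
move=> [[sa _] _ _ mX XZ]; have TT : 0 <= T <= T by rewrite lexx (ltW T_gt0).
have [Z [_ sZ _] XE] := XZ T TT; have sDZ := sqintD (sqint_primitive T_gt0 sa T) sZ.
split; first exact: mX.
rewrite (ae_eq_integral (fun om => ((primitive T a T om + Z om) ^+ 2)%:E))//.
- by case: sDZ.
- by apply/measurable_EFinP; apply: measurable_funX; exact: mX.
- by apply/measurable_EFinP; apply: measurable_funX; case: sDZ.
by apply: filterS XE => om XDZ _; rewrite XDZ primitiveE.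
Qed.

(** Polarization of the formula for the square. *)
Lemma ito_formula_mul a b X a' b' X' : ito_process a b X -> ito_process a' b' X' ->
  ip P (X T) (X' T) = ip mu (cutoff T X) (cutoff T a') + ip mu (cutoff T a) (cutoff T X')
    + ip mu (cutoff T b) (cutoff T b').
Proof.
move=> hX hX'; have hD := ito_processD hX hX'.
have formula c e Y : ito_process c e Y -> ip P (Y T) (Y T)
    = 2 * ip mu (cutoff T c) (cutoff T Y) + ip mu (cutoff T e) (cutoff T e).
  by case=> -[sc se] sY cF mY YZ; exact: (ito_formula_sqr hF hw T_gt0).
have sXT := ito_process_sqint hX; have sXT' := ito_process_sqint hX'.
have := formula _ _ _ hD; have := formula _ _ _ hX'; have := formula _ _ _ hX.
move: hX hX' => [[sa sb] sX _ _ _] [[sa' sb'] sX' _ _ _] /=.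
rewrite (funext (cutoffD T a a')) (funext (cutoffD T b b')) (funext (cutoffD T X X')).
rewrite (ip_sqD sXT sXT') (ip_sqD sb sb') (ipDl sa sa' (sqintD sX sX')).
rewrite (ipDr sX sX' sa) (ipDr sX sX' sa') (ipC mu (cutoff T a') (cutoff T X)); lra.
Qed.

Lemma sqint_cutoff_mulmx n q (M : 'M[R]_(q, n)) (v : process R Omega n) :
  (forall j, sqint mu (cutoff T (entry v j))) ->
  forall i, sqint mu (cutoff T (entry (fun t om => M *m v t om) i)).
Proof.
move=> sv i; apply: eq_sqint (sqint_sum (index_enum 'I_n) (fun j => sqintZ (M i j) (sv j))).
move=> z; rewrite /cutoff /entry; case: ifP => _; first by rewrite mxE.
by rewrite big1// => j _; rewrite mulr0.
Qed.

Lemma sde_ito_process n m (A N : 'M[R]_n) (B : 'M[R]_(n, m)) (u : process R Omega m)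
    (x : process R Omega n) :
  in_L2w P F T u -> is_sde_solution P F w T A N B u 0 x ->
  forall i, ito_process (entry (fun t om => A *m x t om + B *m u t om) i)
    (entry (fun t om => N *m x t om) i) (entry x i).
Proof.
move=> hu [hx xE] i; have su := in_L2w_sqint hu; have sx := in_L2w_sqint hx.
split.
- split; last exact: sqint_cutoff_mulmx.
  apply: eq_sqint (sqintD (sqint_cutoff_mulmx A sx i) (sqint_cutoff_mulmx B su i)) => z.
  by rewrite -cutoffD /cutoff /entry; case: ifP => // _; rewrite [in RHS]mxE.
- exact: sx.
- move=> t tT; have /andP[t0 _] := tT.
  have mulmx_adapted q (M : 'M[R]_(n, q)) (v : process R Omega q) : in_L2w P F T v ->
      measurable_wrt (F t) (fun om => (M *m v t om) i 0).
    move=> [_ /(_ t tT) mv _].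
    rewrite (_ : (fun om => _) = (fun om => \sum_j M i j * v t om j 0)).
      apply: measurable_wrt_sum; first exact: sF.
      by move=> j; exact: (measurable_wrtM (sF t0) (measurable_wrt_cst _ (sF t0)) (mv j)).
    by apply/funext => om; rewrite mxE.
  rewrite /entry (_ : (fun om => _) = (fun om => (A *m x t om) i 0 + (B *m u t om) i 0)).
    by apply: measurable_wrtD; [exact: sF|exact: mulmx_adapted|exact: mulmx_adapted].
  by apply/funext => om; rewrite mxE.
- move=> t tT; have /andP[t0 _] := tT; have [_ /(_ t tT i) mx _] := hx.
  exact: measurable_wrt_fun (FM t0) mx.
move=> t tT; have /andP[t0 _] := tT; have [Z IZ xZ] := xE t tT.
exists (fun om => Z om i 0); first exact: (ito_integral_entry hF hw t0 IZ i).
by apply: filterS xZ => om; rewrite /entry => ->; rewrite !mxE add0r.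
Qed.

End ItoProcesses.

(** * From a dissipation inequality to an L2 bound *)

Section StorageBound.
Context (R : realType) (d : measure_display) (Omega : measurableType d).
Variables (P : probability Omega R) (F : R -> set (set Omega)).
Variable w : R -> Omega -> R.
Hypotheses (hF : is_filtration F) (hw : is_wiener P F w).
Local Notation leb := (@lebesgue_measure R).
Local Notation mR := (measurableTypeR R).
Local Notation mu := (leb \x P)%E.
Variable T : R.
Hypothesis T_gt0 : 0 < T.

Definition vcutoff n (v : process R Omega n) (z : mR * Omega) : 'cV[R]_n :=
  if 0 <= z.1 <= T then v z.1 z.2 else 0.

Lemma vcutoffE n (v : process R Omega n) z :
  vcutoff v z = \col_i cutoff T (entry v i) z.
Proof.
apply/matrixP => i j; rewrite ord1 mxE /vcutoff /cutoff /entry.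
by case: ifP; rewrite ?mxE.
Qed.

(** The storage functional of the final states is nonnegative in expectation,
    and by Ito's formula it is the integral of its drift, which the dissipation
    inequality bounds by the supplied minus the output energy. *)
Lemma dissipation_L2w_le n1 n2 m p (S1 : system n1 m p) (S2 : system n2 m p)
    (g : R) (W : 'M[R]_(n1 + n2)) (u : process R Omega m)
    (x1 : process R Omega n1) (x2 : process R Omega n2) :
  0 <= g -> W^T = W -> (forall v, 0 <= bil W v v) -> dissipation S1 S2 g W ->
  in_L2w P F T u ->
  is_sde_solution P F w T (sysA S1) (sysN S1) (sysB S1) u 0 x1 ->
  is_sde_solution P F w T (sysA S2) (sysN S2) (sysB S2) u 0 x2 ->
  (L2w_norm P T (fun t om => sysC S1 *m x1 t om - sysC S2 *m x2 t om)%R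
   <= g%:E * L2w_norm P T u)%E.
Proof.
move=> g0 WT W0 dW hu h1 h2; have su := in_L2w_sqint hu.
pose y : process R Omega p := fun t om => sysC S1 *m x1 t om - sysC S2 *m x2 t om.
pose X : process R Omega (n1 + n2) := fun t om => col_mx (x1 t om) (x2 t om).
pose a : process R Omega (n1 + n2) := fun t om =>
  col_mx (sys_drift S1 (x1 t om) (u t om)) (sys_drift S2 (x2 t om) (u t om)).
pose b : process R Omega (n1 + n2) := fun t om =>
  col_mx (sysN S1 *m x1 t om) (sysN S2 *m x2 t om).
have entryl (v1 : process R Omega n1) (v2 : process R Omega n2) j :
    entry (fun t om => col_mx (v1 t om) (v2 t om)) (lshift n2 j) = entry v1 j.
  by apply/funext => t; apply/funext => om; rewrite /entry col_mxEu.
have entryr (v1 : process R Omega n1) (v2 : process R Omega n2) j :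
    entry (fun t om => col_mx (v1 t om) (v2 t om)) (rshift n1 j) = entry v2 j.
  by apply/funext => t; apply/funext => om; rewrite /entry col_mxEd.
have itoX i : ito_process P F w T (entry a i) (entry b i) (entry X i).
  have [j ->|j ->] := split_ordP i.
    by rewrite /a /b /X !entryl; exact: (sde_ito_process hF hw hu h1).
  by rewrite /a /b /X !entryr; exact: (sde_ito_process hF hw hu h2).
have sa i : sqint mu (cutoff T (entry a i)) by have [[]] := itoX i.
have sb i : sqint mu (cutoff T (entry b i)) by have [[]] := itoX i.
have sX i : sqint mu (cutoff T (entry X i)) by have [] := itoX i.
have sXT i : sqint P (entry X i T) := ito_process_sqint T_gt0 (itoX i).
have sy i : sqint mu (cutoff T (entry y i)).
  have s1 := sqint_cutoff_mulmx (sysC S1) (in_L2w_sqint h1.1) i.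
  have s2 := sqint_cutoff_mulmx (sysC S2) (in_L2w_sqint h2.1) i.
  apply: eq_sqint (sqintB s1 s2) => z.
  rewrite -cutoffB /cutoff /entry /y; case: ifP => // _.
  by rewrite [in RHS]mxE [X in _ = _ + X]mxE.
have [iXa EXa] := Rintegral_bil W sX sa; have [iaX EaX] := Rintegral_bil W sa sX.
have [ibb Ebb] := Rintegral_bil W sb sb.
have [iu Eu] := sum_ip_sqnorm su; have [iy Ey] := sum_ip_sqnorm sy.
have [_ EXX] := Rintegral_bil W sXT sXT.
have energy : 0 <= g ^+ 2 * \sum_i ip mu (cutoff T (entry u i)) (cutoff T (entry u i))
    - \sum_i ip mu (cutoff T (entry y i)) (cutoff T (entry y i)).
  apply: (@le_trans _ _ (\int[P]_om bil W (\col_i entry X i T om) (\col_i entry X i T om))).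
    by apply: Rintegral_ge0 => om _; exact: W0.
  (* Ito's formula turns the form at time T into three integrals over [0, T] *)
  rewrite EXX; under eq_bigr => i _.
    under eq_bigr => j _ do rewrite (ito_formula_mul hF hw T_gt0 (itoX i) (itoX j)) !mulrDr.
    rewrite !big_split/=.
    over.
  rewrite !big_split/= -EXa -EaX -Ebb -Eu -Ey.
  have i12 := integrableD measurableT iXa iaX; have i3 := integrableD measurableT i12 ibb.
  have iu2 := integrableZl measurableT (g ^+ 2) iu.
  have iuy := integrableB measurableT iu2 iy.
  rewrite -(RintegralD measurableT iXa iaX) -(RintegralD measurableT i12 ibb).
  rewrite -(RintegralZl (g ^+ 2) measurableT iu) -(RintegralB measurableT iu2 iy).
  apply: (le_Rintegral measurableT i3 iuy) => z _.
  rewrite -!vcutoffE (bilC (vcutoff a z) _ WT) -mulr2n -mulr_natl.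
  rewrite /vcutoff; case: ifP => _; last first.
    by rewrite !bil0l !sqnorm2E !bil0l !mulr0 addr0 subr0.
  exact: dW.
rewrite (L2w_norm_sqint su) (L2w_norm_sqint sy) -EFinM lee_fin.
rewrite -[g in leRHS](ger0_norm g0) -sqrtr_sqr -sqrtrM ?sqr_ge0//.
by rewrite ler_wsqrtr// -subr_ge0.
Qed.

End StorageBound.

(** * The error bound *)

Theorem mainTheorem2 (R : realType)
  (d : measure_display) (Omega : measurableType d) (P : probability Omega R)
  (F : R -> set (set Omega)) (w : R -> Omega -> R)
  (hF : is_filtration F) (hw : is_wiener P F w)
  (n1 k m p : nat) (mult : 'I_k -> nat) (sigma : 'I_k -> R)
  (A N : 'M[R]_(n1 + \sum_(i < k) mult i))
  (B : 'M[R]_(n1 + \sum_(i < k) mult i, m))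
  (C : 'M[R]_(p, n1 + \sum_(i < k) mult i))
  (Sigma1 : 'M[R]_n1) (Sigma2 : 'M[R]_(\sum_(i < k) mult i))
  (Sigma : 'M[R]_(n1 + \sum_(i < k) mult i))
  (hstable : spectrum (1%:M *t A + A *t 1%:M + N *t N)
               `<=` @open_left_half_plane R)
  (hSigma : Sigma = block_mx Sigma1 0 0 Sigma2)
  (hSigma_pos : posdefmx Sigma)
  (hSigma2 : Sigma2 = \mxdiag_(i < k) (sigma i)%:M)
  (hsigma_decr : forall i j : 'I_k, (i < j)%N -> sigma j < sigma i)
  (hsigma_pos : forall i : 'I_k, 0 < sigma i)
  (hdisj : spectrum Sigma1 `&` spectrum Sigma2 = set0)
  (hLyap_obs : loewner_le
     (A^T *m Sigma + Sigma *m A + N^T *m Sigma *m N)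
     (- (C^T *m C)))
  (hLyap_ctr : loewner_le
     (A^T *m invmx Sigma + invmx Sigma *m A + N^T *m invmx Sigma *m N)
     (- (invmx Sigma *m B *m B^T *m invmx Sigma)))
  (T : R) (hT : 0 < T)
  (u : process R Omega m) (hu : in_L2w P F T u)
  (x : process R Omega (n1 + \sum_(i < k) mult i))
  (hx : is_sde_solution P F w T A N B u 0 x)
  (xr : process R Omega n1)
  (hxr : is_sde_solution P F w T (ulsubmx A) (ulsubmx N) (usubmx B) u 0 xr) :
  (L2w_norm P T (fun t om => C *m x t om - lsubmx C *m xr t om)%R
   <= (2 * \sum_(i < k) sigma i)%:E * L2w_norm P T u)%E.
Proof.
pose S : system (n1 + \sum_(i < k) mult i) m p := System A N B C.
have pos : posdefmx (block_mx Sigma1 0 0 (bdiag mult sigma)).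
  by move: hSigma_pos; rewrite hSigma hSigma2.
have obs v : 2 * bil Sigma v (A *m v) + bil Sigma (N *m v) (N *m v) <= - sqnorm2 (C *m v).
  have := hLyap_obs.2 v.
  rewrite bilE bil_addmx !bil_oppmx 2!bil_addmx bil_congr bil_sqnorm_mul.
  rewrite -(bilMl Sigma A) -(bilMr Sigma A) (bilC (A *m v) v hSigma_pos.1); lra.
have SiT := (posdef_invmx hSigma_pos).1.
have ctr v : 2 * bil (invmx Sigma) v (A *m v)
    + bil (invmx Sigma) (N *m v) (N *m v) <= - sqnorm2 (B^T *m invmx Sigma *m v).
  have := hLyap_ctr.2 v.
  have -> : invmx Sigma *m B *m B^T *m invmx Sigma
      = (B^T *m invmx Sigma)^T *m (B^T *m invmx Sigma).
    by rewrite trmx_mul SiT trmxK !mulmxA.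
  rewrite bilE bil_addmx !bil_oppmx 2!bil_addmx bil_congr bil_sqnorm_mul.
  rewrite -(bilMl (invmx Sigma) A) -(bilMr (invmx Sigma) A) (bilC (A *m v) v SiT); lra.
rewrite hSigma hSigma2 in obs ctr.
have [W [WT W0 dW]] := truncation_storage (F := S) hsigma_pos pos obs ctr.
have g0 : 0 <= 2 * \sum_(i < k) sigma i.
  by rewrite mulr_ge0// sumr_ge0// => i _; exact: ltW.
exact: (dissipation_L2w_le hF hw hT g0 WT W0 dW hu hx hxr).
Qed.
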